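(* For every prime power $q$ with $q \equiv 3 \pmod 4$ there exists a hemisystem of the Hermitian surface $\mathsf{H}(3,q^2)$ admitting $C_{(q^3+1)/4} : C_3$; that is, there is a hemisystem $\mathcal{H}$ of $\mathsf{H}(3,q^2)$ such that the stabilizer of $\mathcal{H}$ in the automorphism group $\mathsf{P\Gamma U}(4,q)$ of $\mathsf{H}(3,q^2)$ contains a subgroup isomorphic to a semidirect product $C_{(q^3+1)/4} : C_3$.
   Context: $\mathsf{H}(3,q^2)$ is the generalized quadrangle of order $(q^2,q)$ whose points and lines are the totally isotropic points and lines of a non-degenerate Hermitian form on $\mathsf{PG}(3,q^2)$; each line has $q^2+1$ points and each point is on $q+1$ lines. Its automorphism group is $\mathsf{P\Gamma U}(4,q)$. For $q$ odd, a hemisystem of $\mathsf{H}(3,q^2)$ is a set $\mathcal{H}$ of lines of $\mathsf{H}(3,q^2)$ such that every point of $\mathsf{H}(3,q^2)$ is incident with exactly $(q+1)/2$ lines of $\mathcal{H}$ (half of the lines on the point). $C_n$ denotes the cyclic group of order $n$, and $A : B$ denotes a split extension (semidirect product) with normal subgroup $A$ and complement $B$. *)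

(* Defs.v *)
From mathcomp Require Import all_boot all_fingroup all_algebra.

Set Implicit Arguments.
Unset Strict Implicit.
Unset Printing Implicit Defensive.

Import GRing.Theory.
Local Open Scope ring_scope.

Section HermitianSurface.

Variable F : finFieldType.
Local Notation V := 'rV[F]_4.
Implicit Types (form : V -> V -> F) (g h : {perm V}) (s : {perm F}).

(* Subspaces are represented by their sets of vectors, so that a set of lines
   is a finite set and permutations of V act on subspaces by direct images. *)
Definition rowset (A : 'M[F]_4) : {set V} := [set v : V | (v <= A)%MS].

(* Vector-space dimension: k = 1 gives the points, k = 2 the lines. *)
Definition isotropic_subspaces form (k : nat) : {set {set V}} :=
  [set rowset A | A : 'M[F]_4 & (\rank A == k)
     && [forall u in rowset A, forall v in rowset A, form u v == 0]].

Definition hpoints form := isotropic_subspaces form 1.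
Definition hlines form := isotropic_subspaces form 2.

Definition hemisystem form (q : nat) (H : {set {set V}}) : Prop :=
  H \subset hlines form /\
  forall P, P \in hpoints form ->
    #|[set L in H | P \subset L]| = ((q + 1) %/ 2)%N.

Definition field_automorphism s : bool :=
  [&& s 1 == 1,
      [forall a, forall b, s (a + b) == s a + s b]
    & [forall a, forall b, s (a * b) == s a * s b]].

Definition semilinear_over s g : bool :=
  [forall u, forall v, g (u + v) == g u + g v]
  && [forall a, forall v, g (a *: v) == s a *: g v].

Definition semisimilarity form s (c : F) g : bool :=
  [forall u, forall v, form (g u) (g v) == c * s (form u v)].

(* The group of all semisimilarities of the form; PGammaU is obtained by
   factoring out the scalars. *)
Definition GammaU form : {set {perm V}} :=
  [set g | [exists s : {perm F}, exists c : F,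
     [&& field_automorphism s, semilinear_over s g, c != 0
       & semisimilarity form s c g]]].

Lemma GammaUP form g :
  reflect (exists s : {perm F}, exists c : F,
     [/\ field_automorphism s, semilinear_over s g, c != 0
       & semisimilarity form s c g])
    (g \in GammaU form).
Proof.
rewrite inE; apply: (iffP existsP) => -[s].
  by case/existsP=> c /and4P[]; exists s, c.
by case=> c [h1 h2 h3 h4]; exists s; apply/existsP; exists c; apply/and4P.
Qed.

Lemma semilinear_overP s g :
  reflect ((forall u v, g (u + v) = g u + g v)
           /\ (forall a v, g (a *: v) = s a *: g v))
    (semilinear_over s g).
Proof.
apply: (iffP andP) => -[hD hZ]; split.
- by move=> u v; apply/eqP; move/forallP: hD => /(_ u)/forallP/(_ v).
- by move=> a v; apply/eqP; move/forallP: hZ => /(_ a)/forallP/(_ v).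
- by apply/forallP=> u; apply/forallP=> v; rewrite hD.
- by apply/forallP=> a; apply/forallP=> v; rewrite hZ.
Qed.

Lemma field_automorphismP s :
  reflect [/\ s 1 = 1, forall a b, s (a + b) = s a + s b
            & forall a b, s (a * b) = s a * s b]
    (field_automorphism s).
Proof.
apply: (iffP and3P) => -[h1 hD hM]; split.
- exact/eqP.
- by move=> u v; apply/eqP; move/forallP: hD => /(_ u)/forallP/(_ v).
- by move=> u v; apply/eqP; move/forallP: hM => /(_ u)/forallP/(_ v).
- by rewrite h1.
- by apply/forallP=> u; apply/forallP=> v; rewrite hD.
- by apply/forallP=> u; apply/forallP=> v; rewrite hM.
Qed.

Lemma semisimilarityP form s c g :
  reflect (forall u v, form (g u) (g v) = c * s (form u v))
    (semisimilarity form s c g).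
Proof.
apply: (iffP forallP) => [h u v | h u]; last by apply/forallP=> v; rewrite h.
by apply/eqP; move/forallP: (h u).
Qed.

Lemma GammaU_group_set form : group_set (GammaU form).
Proof.
apply/group_setP; split=> [|g h].
  apply/GammaUP; exists 1%g, 1; split; last 1 first.
  - by apply/semisimilarityP=> u v; rewrite !perm1 mul1r.
  - by apply/field_automorphismP; split=> *; rewrite !perm1.
  - by apply/semilinear_overP; split=> *; rewrite !perm1.
  - exact: oner_neq0.
case/GammaUP=> s [c [/field_automorphismP[s1 sD sM]]].
case/semilinear_overP=> gD gZ nz_c /semisimilarityP g_form.
case/GammaUP=> t [d [/field_automorphismP[t1 tD tM]]].
case/semilinear_overP=> hD hZ nz_d /semisimilarityP h_form.
apply/GammaUP; exists (s * t)%g, (d * t c); split.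
- by apply/field_automorphismP; split=> *; rewrite !permM ?(s1, sD, sM).
- by apply/semilinear_overP; split=> *; rewrite !permM ?(gD, gZ).
- have t0 : t 0 = 0 by apply: (addrI (t 0)); rewrite -tD !addr0.
  by rewrite mulf_neq0 // -t0 (inj_eq perm_inj).
- by apply/semisimilarityP=> u v; rewrite !permM h_form g_form tM mulrA.
Qed.
Canonical GammaU_group form := group (GammaU_group_set form).

Definition scalar_perms : {set {perm V}} :=
  [set g : {perm V} | [exists a : F, (a != 0) && [forall v, g v == a *: v]]].

Lemma scalar_permsP g :
  reflect (exists2 a : F, a != 0 & forall v, g v = a *: v)
    (g \in scalar_perms).
Proof.
rewrite inE; apply: (iffP existsP) => [[a /andP[nz_a /forallP h]] | [a nz_a h]].
  by exists a => // v; apply/eqP.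
by exists a; rewrite nz_a; apply/forallP=> v; rewrite h.
Qed.

Lemma scalar_perms_group_set : group_set scalar_perms.
Proof.
apply/group_setP; split=> [|g h].
  by apply/scalar_permsP; exists 1 => [|v]; rewrite ?oner_neq0 ?perm1 ?scale1r.
case/scalar_permsP=> a nz_a ga /scalar_permsP[b nz_b hb].
apply/scalar_permsP; exists (b * a) => [|v]; first exact: mulf_neq0.
by rewrite permM ga hb scalerA.
Qed.
Canonical scalar_perms_group := group scalar_perms_group_set.

Definition PGammaU form : {set coset_of scalar_perms} :=
  (GammaU form / scalar_perms)%g.
Canonical PGammaU_group form := [group of PGammaU form]%G.

(* The action of cosets of scalars on subspaces by direct images;
   modact is the identity on sets of vectors not fixed by all scalars. *)
Definition subspace_action := ('P^* %% scalar_perms)%act.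

Definition PGammaU_stabiliser form (H : {set {set V}}) :
    {set coset_of scalar_perms} :=
  'N_(PGammaU form)(H | subspace_action)%g.
Canonical PGammaU_stabiliser_group form H :=
  [group of PGammaU_stabiliser form H].

Lemma GammaU_norm_scalars form : GammaU form \subset 'N(scalar_perms)%g.
Proof.
apply/subsetP=> g /GammaUP[s [c [/field_automorphismP[s1 sD sM]]]].
case/semilinear_overP=> gD gZ _ _; rewrite inE; apply/subsetP=> y.
case/imsetP=> z /scalar_permsP[a nz_a za] ->; apply/scalar_permsP.
exists (s a) => [|v].
  have s0 : s 0 = 0 by apply: (addrI (s 0)); rewrite -sD !addr0.
  by rewrite -s0 (inj_eq perm_inj).
by rewrite conjgE !permM za gZ permKV.
Qed.

Lemma rowset_fixed A : rowset A \in 'Fix_('P^*)(scalar_perms)%g.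
Proof.
apply/afixP=> z /scalar_permsP[a nz_a za]; apply/eqP.
rewrite eqEcard card_setact leqnn andbT.
apply/subsetP=> _ /imsetP[v vA ->]; rewrite !inE /= in vA *.
by rewrite /aperm za scalemx_sub.
Qed.

Lemma subspace_actionE form g A : g \in GammaU form ->
  subspace_action (rowset A) (coset scalar_perms g) = [set g v | v in rowset A].
Proof.
move=> Gg; rewrite /subspace_action /= modactE ?in_setT //.
  exact: (subsetP (GammaU_norm_scalars form)).
by rewrite setTI rowset_fixed.
Qed.

End HermitianSurface.

(* Main.v *)
Require Import Defs.
From mathcomp Require Import all_boot all_fingroup all_solvable all_algebra.
From mathcomp Require Import all_field mxabelem ring zify.

(* Write K for F_(q^6), bar for x |-> x^(q^3) and N x = x * bar x.  Since a
   nondegenerate Hermitian form over F_(q^2) has an orthonormal basis, H(3,q^2)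
   can be taken in K + F_(q^2) with the form Tr(x bar y) + a b^q.  There its lines
   correspond to the F_q-points x of K with Tr(N x) = 0 (the dual quadric
   Q^-(5,q)), the line of x being { (y, a) | x times y = a * bar x } for the
   cross product of K over F_(q^2); two lines meet iff the polar form of their
   points vanishes.

   For such an x write N x = v^2 or - v^2 with v in F_(q^3); then v is on the
   cone Tr(v^2) = 0, which has two halves exchanged by -1.  The sign of x is
   the product of the half containing v, the quadratic character of v, and one
   of two opposite signs read off the quartic character of x.  The sum of the
   signs over all nonzero singular vectors orthogonal to x is - q^2 (q - 1) times the sign of x,
   i.e. the signs form an eigenvector of the collinearity graph of Q^-(5,q) for its
   least eigenvalue.  Hence the squares of the sums of the signs of the lines
   on a point add up to 0, so that half of the lines on every point are
   positive.

   The sign is invariant under x |-> x^(q^2) and under multiplication by the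
   fourth powers z with N z in F_q; modulo F_q^* these z form a cyclic group of
   order (q^3 + 1) / 4. *)

Set Implicit Arguments.
Unset Strict Implicit.
Unset Printing Implicit Defensive.

Import GRing.Theory Num.Theory.

(** The congruence enters as q^3 = 3 mod 4: -1 is a nonsquare of F_(q^3), so exactly one of N x and
    - N x is a square, and both the half of the cone and the quadratic character change sign with v.
    Their product does not depend on the choice of v. The quartic character is there for
    cancellation: with z = bar x * y, the map z |-> bar z preserves N y and orthogonality to x, and
    it reverses the sign of y when N x and N y lie in different square classes. When the classes
    agree, N z is the square of some w in F_(q^3), and the quartic character of z is the quadratic
    one of w (2 w + z + bar z), linear in the trace c = z + bar z. The number of z with given c
    brings in c^2 - 4 w^2 = (c - 2 w)(c + 2 w), one factor of which cancels. What remains are sums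
    of the quadratic character over translates of the trace-zero plane, and these come from counting
    points on the quadrics t3 (z^2) = s. Restricting to symmetries of trivial quartic character
    costs the factor 4 in (q^3 + 1) / 4; the 3 is the degree of F_(q^6) over F_(q^2). *)

Lemma card_fibers (T U : finType) (A : {set T}) (B : pred U) (g : T -> U) :
  (forall x, x \in A -> B (g x)) ->
  #|A| = \sum_(y | B y) #|[set x in A | g x == y]|.
Proof.
move=> gAB; rewrite -sum1_card (partition_big g B) //=.
by apply: eq_bigr => y _; rewrite -sum1_card; apply: eq_bigl => x; rewrite inE.
Qed.

(** Pigeonhole: upper bounds on the image and on the fibers are both attained once their product is
    the size of the source. It stands in for linear algebra: kernels and images of additive maps are
    bounded by degrees of polynomials. *)
Lemma fiber_card (T U : finType) (A : {set T}) (B : {set U}) (g : T -> U)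
    (m n : nat) :
  (forall x, x \in A -> g x \in B) ->
  (forall y, y \in B -> #|[set x in A | g x == y]| <= n) ->
  #|B| <= m -> #|A| = m * n -> 0 < n ->
  #|B| = m /\ (forall y, y \in B -> #|[set x in A | g x == y]| = n).
Proof.
move=> gAB fib cB cA n0.
have sumA : #|A| = \sum_(y in B) #|[set x in A | g x == y]|.
  exact: card_fibers.
have le1 : #|A| <= #|B| * n by rewrite sumA -sum_nat_const leq_sum.
have cBm : #|B| = m.
  by apply/eqP; rewrite eqn_leq cB -(leq_pmul2r n0) -cA le1.
split=> // y yB; apply/eqP; rewrite eqn_leq fib //=.
have := leqnn #|A|; rewrite {1}cA -cBm sumA (bigD1 y) //=.
rewrite -sum_nat_const (bigD1 y) //= => le2.
have le3 : \sum_(i in B | i != y) #|[set x in A | g x == i]|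
           <= \sum_(i in B | i != y) n.
  by apply: leq_sum => i /andP[iB _]; apply: fib.
by rewrite -(leq_add2r (\sum_(i in B | i != y) n)); apply: leq_trans le2 _;
  rewrite leq_add2l.
Qed.

Lemma odd_card_two_neq0 (K : finFieldType) : odd #|K| -> (2 != 0 :> K)%R.
Proof.
move=> oddK; apply/eqP => two0.
have : ((1 : K) *+ #|K| = 0)%R.
  by have := @expg_cardG K [set: K]%G 1%R (in_setT _); rewrite cardsT.
rewrite -[#|K|]odd_double_half oddK mulrnDr mulr1n -muln2 mulnC mulrnA two0 mul0rn addr0.
by move/eqP; rewrite oner_eq0.
Qed.

Lemma q_gt2 q : q %% 4 = 3 -> 2 < q. Proof. lia. Qed.

(** * Frobenius powers on F_(q^6): sizes of fixed fields and trace fibers *)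

Section Field.

Local Open Scope ring_scope.

Variables (q : nat) (K : finFieldType) (fr : {rmorphism K -> K}).
Hypotheses (q4 : (q %% 4 = 3)%N) (cardK : #|K| = (q ^ 6)%N).
Hypothesis frE : forall x, fr x = x ^+ q.

Lemma two_neq0 : 2 != 0 :> K.
Proof. by apply: odd_card_two_neq0; rewrite cardK oddX; move: q4; lia. Qed.

Lemma fr_iterE n x : iter n fr x = x ^+ (q ^ n).
Proof.
by elim: n => [|n IH] /=; [rewrite expr1 | rewrite IH frE -exprM expnSr].
Qed.

Lemma fr6 x : fr (fr (fr (fr (fr (fr x))))) = x.
Proof. by have := fr_iterE 6 x; rewrite /= -cardK expf_card. Qed.

Lemma bar_expE x : fr (fr (fr x)) = x ^+ (q ^ 3).
Proof. exact: (fr_iterE 3). Qed.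

Local Notation fr2 x := (fr (fr x)).
Local Notation bar x := (fr (fr (fr x))).
Local Notation fr4 x := (fr (fr (fr (fr x)))).

Lemma fr_eq0 x : (fr x == 0) = (x == 0). Proof. exact: fmorph_eq0. Qed.

Lemma card_root_le (g : K -> K) (p : {poly K}) (m : nat) :
  p != 0 -> (size p <= m.+1)%N -> (forall x, g x = p.[x]) ->
  (#|[set x | g x == 0%R]| <= m)%N.
Proof.
move=> p0 sp gE; rewrite cardE.
have : (size (enum [set x | g x == 0%R]) < size p)%N.
  apply: max_poly_roots => //; last exact: enum_uniq.
  by apply/allP => x; rewrite mem_enum inE gE.
by move/leq_trans/(_ sp).
Qed.

Lemma card_root_fr (n : nat) (a : nat -> K) (c : K) :
  (#|[set x | iter n fr x + \sum_(i < n) a i * iter i fr x + c == 0]%R| <= q ^ n)%N.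
Proof.
have q1 : (1 < q)%N by have := q_gt2 q4; lia.
pose r : {poly K} := \sum_(i < n) a i *: 'X^(q ^ i) + c%:P.
have sr : (size r <= q ^ n)%N.
  apply: leq_trans (size_polyD _ _) _; rewrite geq_max.
  rewrite (leq_trans (size_polyC_leq1 _)) ?expn_gt0 ?(ltnW q1) // andbT.
  apply: leq_trans (size_sum _ _ _) _; apply/bigmax_leqP => i _.
  apply: leq_trans (size_scale_leq _ _) _.
  by rewrite size_polyXn ltn_exp2l.
have szp : size ('X^(q ^ n) + r) = (q ^ n).+1.
  by rewrite size_polyDl size_polyXn // ltnS.
apply: (@card_root_le _ ('X^(q ^ n) + r)).
- by rewrite -size_poly_gt0 szp.
- by rewrite szp.
move=> x; rewrite /r hornerD hornerXn hornerD hornerC horner_sum fr_iterE addrA;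
  congr (_ + _ + _).
by apply: eq_bigr => i _; rewrite !hornerE fr_iterE.
Qed.

(** Additive Hilbert 90 for [bar]: x |-> bar x - x maps into the solutions of bar y = - y, and
    neither these nor a fiber exceed q^3, the square root of the size of K. *)
Lemma card_bar : #|[set x : K | bar x == x]| = (q ^ 3)%N
  /\ forall y, bar y = - y -> #|[set x | bar x - x == y]| = (q ^ 3)%N.
Proof.
have [] := @fiber_card K K [set: K] [set y | bar y == - y]
   (fun x => bar x - x) (q ^ 3) (q ^ 3).
- by move=> x _; rewrite inE !rmorphB fr6 opprB.
- move=> y _; have := card_root_fr 3 (fun i => if i == 0%N then -1 else 0) (- y).
  apply: leq_trans; apply: subset_leq_card; apply/subsetP => x; rewrite !inE /=.
  by rewrite !big_ord_recr big_ord0 /= => /eqP <-; apply/eqP; ring.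
- have := card_root_fr 3 (fun i => if i == 0%N then 1 else 0) 0.
  apply: leq_trans; apply: subset_leq_card; apply/subsetP => x; rewrite !inE /=.
  by rewrite !big_ord_recr big_ord0 /= => /eqP ->; apply/eqP; ring.
- by rewrite cardsT cardK -expnD.
- by rewrite expn_gt0; have := q_gt2 q4; lia.
move=> _ h; split.
  rewrite -(h 0) ?inE ?rmorph0 ?oppr0 //.
  by apply: eq_card => x; rewrite !inE subr_eq0.
move=> y hy; rewrite -(h y) ?inE ?hy //.
by apply: eq_card => x; rewrite !inE.
Qed.

Definition t3 u := u + fr u + fr2 u.

Lemma card_fr_t3 : #|[set x : K | fr x == x]| = q
  /\ #|[set x : K | t3 x == 0]| = (q ^ 2)%N.
Proof.
have [] := @fiber_card K K [set x | bar x == x] [set y | t3 y == 0]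
   (fun x => fr x - x) (q ^ 2) q.
- move=> x; rewrite !inE /t3 !rmorphB => /eqP h; apply/eqP; rewrite h; ring.
- move=> y _; have := card_root_fr 1 (fun i => -1) (- y).
  rewrite expn1.
  apply: leq_trans; apply: subset_leq_card; apply/subsetP => x; rewrite !inE /=.
  by rewrite !big_ord_recr big_ord0 /= => /andP[_ /eqP <-]; apply/eqP; ring.
- have := card_root_fr 2 (fun i => 1) 0.
  apply: leq_trans; apply: subset_leq_card; apply/subsetP => x; rewrite !inE /=.
  by rewrite !big_ord_recr big_ord0 /= /t3 => /eqP h; apply/eqP; rewrite -[RHS]h; ring.
- by rewrite (proj1 card_bar) -expnSr.
- by have := q_gt2 q4; lia.
move=> h1 h; split=> //.
rewrite -(h 0) ?inE /t3 ?rmorph0 ?addr0 //.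
apply: eq_card => x; rewrite !inE subr_eq0.
by apply/idP/idP => [/eqP e|/andP[]//]; rewrite e eqxx !e eqxx.
Qed.

Lemma card_fr : #|[set x : K | fr x == x]| = q.
Proof. by case: card_fr_t3. Qed.
Lemma t3_fr u : bar u = u -> fr (t3 u) = t3 u.
Proof. by move=> h; rewrite /t3 !rmorphD h; ring. Qed.

Lemma card_t3 s : fr s = s -> #|[set x | (bar x == x) && (t3 x == s)]| = (q ^ 2)%N.
Proof.
move=> hs.
have [] := @fiber_card K K [set x | bar x == x] [set y | fr y == y]
   t3 q (q ^ 2).
- by move=> x; rewrite !inE => /eqP h; rewrite t3_fr.
- move=> y _; have := card_root_fr 2 (fun i => 1) (- y).
  apply: leq_trans; apply: subset_leq_card; apply/subsetP => x; rewrite !inE /=.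
  by rewrite !big_ord_recr big_ord0 /= => /andP[_ /eqP <-]; apply/eqP; rewrite /t3; ring.
- by rewrite card_fr.
- by rewrite (proj1 card_bar) -expnS.
- by rewrite expn_gt0; have := q_gt2 q4; lia.
move=> _ h; rewrite -(h s) ?inE ?hs //.
by apply: eq_card => x; rewrite !inE.
Qed.

Lemma card_fr2 : #|[set x : K | fr2 x == x]| = (q ^ 2)%N.
Proof.
have [] := @fiber_card K K [set: K] [set y | y + fr2 y + fr4 y == 0]
   (fun x => fr2 x - x) (q ^ 4) (q ^ 2).
- by move=> x _; rewrite inE !rmorphB fr6; apply/eqP; ring.
- move=> y _; have := card_root_fr 2 (fun i => if i == 0%N then -1 else 0) (- y).
  apply: leq_trans; apply: subset_leq_card; apply/subsetP => x; rewrite !inE /=.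
  by rewrite !big_ord_recr big_ord0 /= => /eqP <-; apply/eqP; ring.
- have := card_root_fr 4 (fun i => if odd i then 0 else 1) 0.
  apply: leq_trans; apply: subset_leq_card; apply/subsetP => x; rewrite !inE /=.
  by rewrite !big_ord_recr big_ord0 /= => /eqP h; apply/eqP; rewrite -[RHS]h; ring.
- by rewrite cardsT cardK -expnD.
- by rewrite expn_gt0; have := q_gt2 q4; lia.
move=> _ h; rewrite -(h 0) ?inE ?rmorph0 ?addr0 //.
by apply: eq_card => x; rewrite !inE subr_eq0.
Qed.

(** * Quadratic and quartic characters *)

Local Notation m := (q ^ 3 %/ 4)%N.

(** Hence 2 m + 1 = (q^3 - 1) / 2 is the Euler exponent of F_(q^3), an odd number, and m + 1 = (q^3
    + 1) / 4. *)
Lemma q3E : (q ^ 3 = 4 * m + 3)%N.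
Proof.
by rewrite [LHS](divn_eq _ 4) mulnC; congr (_ + _)%N; rewrite -modnXm q4.
Qed.

Lemma bar_m x : bar x = x ^+ (4 * m + 3). Proof. by rewrite bar_expE -q3E. Qed.

(* The quadratic character of the fixed field F_(q^3) of bar. *)
Definition eta (u : K) : int :=
  if u == 0 then 0 else if u ^+ (2 * m + 1) == 1 then 1 else -1.

Lemma euler u : u != 0 -> bar u = u -> u ^+ (2 * m + 1) = 1 \/ u ^+ (2 * m + 1) = -1.
Proof.
move=> u0 /eqP; rewrite bar_m => hu.
have : (u ^+ (2 * m + 1)) ^+ 2 == 1.
  rewrite -exprM -(inj_eq (mulfI u0)) mulr1 -exprS.
  by rewrite (_ : (_.+1 = 4 * m + 3)%N); last lia.
by rewrite sqrf_eq1 => /orP[/eqP|/eqP]; [left | right].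
Qed.

Lemma oneN1 : (-1 == 1 :> K) = false.
Proof. by rewrite -subr_eq0 -opprD oppr_eq0 (negbTE two_neq0). Qed.

Lemma eta0 : eta 0 = 0. Proof. by rewrite /eta eqxx. Qed.

Lemma eta_eq0 u : (eta u == 0) = (u == 0).
Proof. by rewrite /eta; case: ifP => //; case: ifP. Qed.

Lemma eta_sqr u : u != 0 -> eta u * eta u = 1.
Proof. by rewrite /eta => /negbTE ->; case: ifP. Qed.

Lemma etaM u v : bar u = u -> bar v = v -> eta (u * v) = eta u * eta v.
Proof.
move=> hu hv; rewrite /eta mulf_eq0.
have [->|u0] := eqVneq u 0; first by rewrite /= mul0r.
have [->|v0] := eqVneq v 0; first by rewrite /= mulr0.
rewrite /= exprMn; case: (euler u0 hu) => ->; case: (euler v0 hv) => ->;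
by rewrite ?mulrN ?mulNr ?opprK ?mulr1 ?mul1r ?eqxx ?oneN1.
Qed.

Lemma eta1 : eta 1 = 1.
Proof. by rewrite /eta oner_eq0 expr1n eqxx. Qed.

Lemma etaN1 : eta (-1) = -1.
Proof. by rewrite /eta oppr_eq0 oner_eq0 exprD exprM sqrrN !expr1n mul1r oneN1. Qed.

Lemma etaN u : bar u = u -> eta (- u) = - eta u.
Proof. by move=> hu; rewrite -mulN1r etaM ?etaN1 ?mulN1r // !rmorphN1. Qed.

Lemma eta_sqE v : v != 0 -> bar v = v -> eta (v ^+ 2) = 1.
Proof. by move=> v0 hv; rewrite expr2 etaM // eta_sqr. Qed.

Lemma eta_fr u : eta (fr u) = eta u.
Proof. by rewrite /eta fr_eq0 -rmorphXn fmorph_eq1. Qed.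

(* As q^3 = 3 mod 4, this power is a square root of u or of - u. *)
Definition pm_sqrt (u : K) := u ^+ m.+1.

Lemma pm_sqrt_sqr u : bar u = u -> pm_sqrt u ^+ 2 = (eta u)%:~R * u.
Proof.
move=> hu; have [->|u0] := eqVneq u 0; first by rewrite mulr0 /pm_sqrt expr0n /= expr0n.
rewrite /pm_sqrt -exprM (_ : (m.+1 * 2 = (2 * m + 1).+1)%N); last lia.
rewrite exprSr /eta (negbTE u0); case: (euler u0 hu) => ->.
  by rewrite eqxx.
by rewrite oneN1 rmorphN1.
Qed.

Lemma pm_sqrtM u v : pm_sqrt (u * v) = pm_sqrt u * pm_sqrt v. Proof. exact: exprMn. Qed.
Lemma pm_sqrt_eq0 u : (pm_sqrt u == 0) = (u == 0). Proof. by rewrite /pm_sqrt expf_eq0. Qed.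
Lemma pm_sqrt_fr u : pm_sqrt (fr u) = fr (pm_sqrt u). Proof. by rewrite /pm_sqrt
  rmorphXn. Qed.
Lemma pm_sqrt_bar u : bar u = u -> bar (pm_sqrt u) = pm_sqrt u.
Proof. by move=> hu; rewrite /pm_sqrt !rmorphXn hu. Qed.

Lemma neqN (v : K) : v != 0 -> v != - v.
Proof.
by move=> v0; rewrite -subr_eq0 opprK -mulr2n -mulr_natl mulf_neq0 ?two_neq0.
Qed.

Lemma card_sqrt u : bar u = u ->
  (#|[set v | (bar v == v) && (v ^+ 2 == u)]|%:Z = 1 + eta u)%R.
Proof.
move=> hu; have [->|u0] := eqVneq u 0.
  rewrite eta0 addr0 (_ : [set v | _] = [set 0]) ?cards1 //.
  apply/setP => v; rewrite !inE expf_eq0 /=.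
  by case: (eqVneq v 0) => [->|]; rewrite ?andbF // !rmorph0 eqxx.
have := pm_sqrt_sqr hu; rewrite {1 2}/eta (negbTE u0); case: ifP => h1 h.
  rewrite rmorph1 mul1r in h.
  have -> : [set v | (bar v == v) && (v ^+ 2 == u)] = [set pm_sqrt u; - pm_sqrt u].
    apply/setP => v; rewrite !inE -{1}h eqf_sqr.
    apply/idP/idP => [/andP[_ ->] //|/orP[]/eqP->]; first by rewrite pm_sqrt_bar ?eqxx.
    by rewrite !rmorphN pm_sqrt_bar // !eqxx orbT.
  by rewrite cards2 neqN ?pm_sqrt_eq0.
have -> : [set v | (bar v == v) && (v ^+ 2 == u)] = set0.
  apply/setP => v; rewrite !inE; apply/negP => /andP[/eqP hv /eqP e].
  have v0 : v != 0 by apply: contra_neq u0 => v0; rewrite -e v0 expr0n.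
  have : eta (pm_sqrt u ^+ 2) = 1 by rewrite eta_sqE ?pm_sqrt_eq0 ?pm_sqrt_bar.
  by rewrite h rmorphN1 mulN1r etaN // -e eta_sqE.
by rewrite cards0.
Qed.

(* x^((q^6 - 1) / 4), in a form that shows that it is trivial on F_(q^3). *)
Definition quartic (x : K) := (bar x / x) ^+ m.+1.
(* Only meaningful on squares, where the quartic character is 1 or -1. *)
Definition quartic_sign (x : K) : int := if quartic x == 1 then 1 else -1.

Lemma quarticM x y : quartic (x * y) = quartic x * quartic y.
Proof. by rewrite /quartic !rmorphM invfM mulrACA exprMn. Qed.

Lemma quartic1 x : x != 0 -> bar x = x -> quartic x = 1.
Proof. by move=> x0 hx; rewrite /quartic hx divff ?expr1n. Qed.

Lemma quartic_euler x : x != 0 -> quartic x ^+ 2 = (x * bar x) ^+ (2 * m + 1).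
Proof.
move=> x0; rewrite /quartic -exprM (_ : (m.+1 * 2 = (2 * m + 1).+1)%N); last lia.
rewrite expr_div_n.
(* The two exponents add up to 4 m + 4 = q^3 + 1, the exponent of the norm. *)
have -> : x ^+ (2 * m + 1).+1 = x * bar x / x ^+ (2 * m + 1).+1.
  apply: (mulIf (expf_neq0 (2 * m + 1).+1 x0)).
  rewrite divfK ?expf_neq0 // -exprD bar_m -exprS; congr (_ ^+ _); lia.
rewrite invf_div mulrA -exprMn exprSr.
rewrite -mulrA; rewrite [bar x * x]mulrC mulfV ?mulr1 // mulf_neq0 // !fmorph_eq0 //.
Qed.

Lemma normE x : bar (x * bar x) = x * bar x.
Proof. by rewrite !rmorphM fr6 mulrC. Qed.
Lemma trE x : bar (x + bar x) = x + bar x.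
Proof. by rewrite !rmorphD fr6 addrC. Qed.

(* (z + w)^2 = z (2 w + z + bar z), and the last factor is in F_(q^3). *)
Lemma quartic_signE w z : w != 0 -> bar w = w -> z * bar z = w ^+ 2 -> z != - w ->
  quartic_sign z = eta w * eta (2 * w + (z + bar z)).
Proof.
move=> w0 hw hz zw.
have s0 : z + w != 0 by rewrite addr_eq0.
have z0 : z != 0.
  by apply: contra_neq w0 => z0; apply/eqP; rewrite -sqrf_eq0 -hz z0 mul0r.
pose T := 2 * w + (z + bar z).
have hT : bar T = T by rewrite /T !(rmorphD, rmorphM) fr6 hw !rmorph1; ring.
have e1 : (z + w) ^+ 2 = z * T by rewrite /T mulrDr mulrDr hz; ring.
have T0 : T != 0 by apply: contra_neq s0 => T0; apply/eqP; rewrite -sqrf_eq0 e1 T0 mulr0.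
(* As z * T is the square of z + w, its quartic character is the quadratic character of the norm w *
   T of z + w. *)
have e2 : (z + w) * bar (z + w) = w * T.
  rewrite !rmorphD hw mulrDr mulrDl hz /T; ring.
have e3 : quartic z = (w * T) ^+ (2 * m + 1).
  by rewrite -e2 -quartic_euler // expr2 -quarticM -expr2 e1 quarticM (quartic1 T0 hT)
    mulr1.
by rewrite -etaM // /eta mulf_eq0 (negbTE w0) (negbTE T0) /= /quartic_sign e3.
Qed.

Lemma sum_1eta (P : pred K) :
  \sum_(c | (bar c == c) && P c) (1 + eta c)
  = #|[set v | (bar v == v) && P (v ^+ 2)]|%:Z.
Proof.
rewrite (@card_fibers _ _ _ (fun c => (bar c == c) && P c) (fun v => v ^+ 2)) /=.
  rewrite -natz natr_sum /=; apply: eq_bigr => c /andP[/eqP hc Pc].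
  rewrite -card_sqrt // natz; congr _%:Z; apply: eq_card => v; rewrite !inE.
  by case: (eqVneq (v ^+ 2) c) => [->|]; rewrite ?andbF // Pc !andbT.
by move=> v; rewrite inE !rmorphXn => /andP[/eqP -> ->]; rewrite eqxx.
Qed.

Lemma sum_odd (P : pred K) (g : K -> int) :
  (forall c, P (- c) = P c) -> (forall c, P c -> g (- c) = - g c) -> \sum_(c | P c) g c = 0.
Proof.
move=> hP hg; have : \sum_(c | P c) g c = - \sum_(c | P c) g c.
  rewrite {1}(reindex_inj oppr_inj) /= -sumrN.
  by apply: eq_big => c; rewrite hP // => h; rewrite hg.
lia.
Qed.

(** * The trace form t3 (u v) on F_(q^3) and its cone *)

Lemma t3_N u : t3 (- u) = - t3 u. Proof. rewrite /t3 !rmorphN; ring. Qed.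

Lemma t3_Z r u : fr r = r -> t3 (r * u) = r * t3 u.
Proof. by move=> hr; rewrite /t3 !rmorphM !hr; ring. Qed.

Lemma fr_bar r : fr r = r -> bar r = r. Proof. by move=> h; rewrite !h. Qed.

Definition cone v := [&& v != 0, bar v == v & t3 (v ^+ 2) == 0].

Lemma coneP v : reflect [/\ v != 0, bar v = v & t3 (v ^+ 2) = 0] (cone v).
Proof. by apply: (iffP and3P) => -[h1 h2 h3]; split=> //; apply/eqP. Qed.

Lemma sum_eta_t30 : \sum_(c | (bar c == c) && (t3 c == 0)) eta c = 0.
Proof.
apply: sum_odd => [c|c /andP[/eqP hc _]]; last exact: etaN.
by rewrite t3_N !rmorphN eqr_opp oppr_eq0.
Qed.

Lemma card_cone : (#|[set v | cone v]|%:Z = (q ^ 2)%N%:Z - 1)%R.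
Proof.
have := sum_1eta (fun c => t3 c == 0); rewrite big_split /= sum_eta_t30 addr0.
rewrite sumr_const natz -cardsE (card_t3 (rmorph0 fr)) => ->.
rewrite [in RHS](cardsD1 0) !inE !rmorph0 expr0n /t3 !rmorph0 !addr0 !eqxx PoszD addrC
  addKr.
by congr _%:Z; apply: eq_card => v; rewrite !inE.
Qed.

(** In the coordinates (v, fr v, fr2 v) of F_(q^3) over F_q, the first coordinate of the cross
    product for the form t3 (v z); the other two are its conjugates. *)
Definition cr v z := fr v * fr2 z - fr2 v * fr z.

Lemma cr0 v z : v != 0 -> cr v z = 0 -> fr (z / v) = z / v.
Proof.
move=> v0 /subr0_eq h; apply: (fmorph_inj fr).
rewrite !fmorph_div; apply/eqP; rewrite eqr_div ?fmorph_eq0 //.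
by rewrite mulrC h mulrC.
Qed.

Lemma cr_crr a b : bar a = a -> bar b = b ->
  cr a (cr b a) = b * t3 (a ^+ 2) - a * t3 (a * b).
Proof.
move=> ha hb; rewrite /cr /t3 !rmorphB !rmorphM ha hb; ring.
Qed.

Lemma crC a b : cr b a = - cr a b. Proof. by rewrite /cr; ring. Qed.

Lemma crB a b c : cr a (b - c) = cr a b - cr a c.
Proof. by rewrite /cr !rmorphB; ring. Qed.

Lemma cr_crl a b : bar a = a -> bar b = b ->
  cr a (cr a b) = a * t3 (a * b) - b * t3 (a ^+ 2).
Proof.
by move=> ha hb; rewrite -opprB -cr_crr // (crC a b) /cr !rmorphN; ring.
Qed.

(* No two independent singular vectors are orthogonal: v and w would both be
   proportional to their cross product. *)
Lemma cone_prop v w : cone v -> cone w -> t3 (v * w) = 0 -> fr (w / v) = w / v.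
Proof.
move=> /coneP[v0 hv qv] /coneP[w0 hw qw] vw.
have h1 : cr (cr v w) v = 0 by rewrite crC cr_crl // qv vw !mulr0 subr0 oppr0.
have h2 : cr (cr v w) w = 0.
  by rewrite crC cr_crr // qw [w * v]mulrC vw !mulr0 subr0 oppr0.
have [z0|z0] := eqVneq (cr v w) 0; first exact: cr0.
have e1 := cr0 z0 h1; have e2 := cr0 z0 h2.
have -> : w / v = (w / cr v w) / (v / cr v w).
  by rewrite invf_div mulrA divfK.
by rewrite fmorph_div e1 e2.
Qed.

(** The product of v with [cr v z] vanishes, so cr v z = l v with l in F_q. Then [cr z (cr v z)] is
    v * t3 (z^2) as a triple product and - l^2 v directly. *)
Lemma perp_cone v z : cone v -> bar z = z -> t3 (v * z) = 0 ->
  fr (cr v z / v) = cr v z / v /\ t3 (z ^+ 2) = - (cr v z / v) ^+ 2.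
Proof.
move=> /coneP[v0 hv qv] hz vz.
have h1 : cr v (cr v z) = 0 by rewrite cr_crl // qv vz !mulr0 subr0.
have h2 := cr0 v0 h1; split=> //.
have h3 := cr_crr hz hv; rewrite [z * v]mulrC vz mulr0 subr0 in h3.
set l := cr v z / v in h2 *.
have e : cr v z = l * v by rewrite divfK.
clearbody l; apply: (mulIf v0); rewrite mulrC -h3 {1}e /cr !rmorphM !h2 mulNr.
have -> : l ^+ 2 * v = l * cr v z by rewrite e; ring.
by rewrite /cr; ring.
Qed.

Lemma t3_sqD z v r : fr r = r -> t3 (v ^+ 2) = 0 ->
  t3 ((z + r * v) ^+ 2) = t3 (z ^+ 2) + 2 * r * t3 (v * z).
Proof.
move=> hr qv; rewrite -[RHS]addr0 -(mulr0 (r ^+ 2)) -qv /t3 !rmorphXn !rmorphD !rmorphM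
  !hr; ring.
Qed.

Lemma card_E_fiber v s : v != 0 -> bar v = v -> fr s = s ->
  #|[set z | (bar z == z) && (t3 (v * z) == s)]| = (q ^ 2)%N.
Proof.
move=> v0 hv hs; rewrite -(card_t3 hs) -(card_imset _ (mulfI v0)).
apply: eq_card => c; rewrite inE; apply/imsetP/andP => [[z]|[/eqP hc /eqP tc]].
  by rewrite inE => /andP[/eqP hz /eqP tz] ->; rewrite !rmorphM hv hz tz !eqxx.
have e : v * (c / v) = c by rewrite mulrC divfK.
by exists (c / v); rewrite ?inE ?e // tc !fmorph_div hc hv !eqxx.
Qed.

(** The degree of F_(q^3) over F_q is odd, so a square root in F_(q^3) of an element of F_q is
    already in F_q: fr l = - l would give bar l = - l. *)
Lemma card_fr_sqrt s : fr s = s ->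
  (#|[set l | (fr l == l) && (l ^+ 2 == s)]|%:Z = 1 + eta s)%R.
Proof.
move=> hs; rewrite -card_sqrt ?fr_bar //; congr _%:Z; apply: eq_card => l; rewrite !inE.
case: (eqVneq (l ^+ 2) s) => [e|]; rewrite ?andbF // !andbT.
apply/eqP/eqP => [|h]; first exact: fr_bar.
have : (fr l) ^+ 2 == l ^+ 2 by rewrite -rmorphXn e hs.
rewrite eqf_sqr => /orP[/eqP //|/eqP h1].
have l0 : l = 0.
  have /eqP : bar l = - l by rewrite !(h1, rmorphN) opprK.
  by rewrite h; case: (eqVneq l 0) => // /neqN/negbTE ->.
by rewrite l0 rmorph0.
Qed.

(* The form t3 (z^2) restricts to minus a square on the orthogonal of v. *)
Lemma card_perp v s : cone v -> fr s = s ->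
  (#|[set z | [&& bar z == z, t3 (v * z) == 0 & t3 (z ^+ 2) == s]]|%:Z
     = q%:Z * (1 + eta (- s)))%R.
Proof.
move=> hv hs; have [v0 bv qv] := coneP _ hv.
pose A := [set z | (bar z == z) && (t3 (v * z) == 0)].
pose B := [set l : K | fr l == l].
have [] := @fiber_card K K A B (fun z => cr v z / v) q q.
- by move=> z; rewrite !inE => /andP[/eqP hz /eqP vz]; have [-> _] := perp_cone hv hz vz.
- move=> l _; have [->|/set0Pn[z0]] := eqVneq [set x in A | cr v x / v == l] set0.
    by rewrite cards0.
  rewrite !inE => /andP[/andP[/eqP bz /eqP vz] /eqP hl].
  rewrite -(proj1 card_fr_t3) -[X in (_ <= X)%N](card_imset _ (fun r1 r2 (h : z0 + r1 * v
    = z0 + r2 * v) => mulIf v0 (addrI z0 h))).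
  apply: subset_leq_card; apply/subsetP => z.
  rewrite !inE => /andP[/andP[/eqP bz' /eqP vz'] /eqP hl'].
  apply/imsetP; exists ((z - z0) / v); last by rewrite divfK // addrC subrK.
  rewrite inE; apply/eqP; apply: cr0 => //.
  have : cr v z = cr v z0 by apply: (mulIf (invr_neq0 v0)); rewrite hl hl'.
  by rewrite crB => ->; rewrite subrr.
- by rewrite card_fr.
- by rewrite card_E_fiber ?rmorph0 // expnS expn1.
- by have := q_gt2 q4; lia.
move=> _ fib; rewrite -card_fr_sqrt ?rmorphN ?hs // -PoszM; congr _%:Z.
rewrite (@card_fibers _ _ _ (fun l => (fr l == l) && (l ^+ 2 == - s)) (fun z =>
  cr v z / v)).
  rewrite mulnC -sum_nat_const; apply: eq_big => [l|l /andP[hl /eqP ls]];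
    first by rewrite inE.
  rewrite -(fib l) ?inE //; apply: eq_card => z; rewrite !inE.
  apply/andP/andP => -[]; last first.
    move=> /andP[hz /eqP vz] /eqP el; have [_] := perp_cone hv (eqP hz) vz.
    by rewrite el ls opprK hz vz => ->; rewrite !eqxx.
  by move=> /and3P[-> -> _] ->.
move=> z; rewrite inE => /and3P[/eqP hz /eqP vz /eqP zs].
by have [-> ] := perp_cone hv hz vz; rewrite zs => ->; rewrite opprK !eqxx.
Qed.

Lemma cone_ex : exists v, cone v.
Proof.
have h := card_cone; have q2 := q_gt2 q4.
have : (0 < #|[set v | cone v]|)%N by nia.
by case/card_gt0P => v; rewrite inE; exists v.
Qed.

Lemma sum_indicator (P Q : pred K) : (\sum_(z | P z) Q z = #|[set z | P z && Q z]|)%N.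
Proof.
rewrite -sum1_card [RHS](eq_bigl (fun z => P z && Q z)) => [|z]; last by rewrite inE.
by rewrite big_mkcondr; apply: eq_bigr => z _; case: (Q z).
Qed.

(* Translating along a singular vector v makes the equation linear off the
   orthogonal of v. *)
Lemma card_t3sq s : s != 0 -> fr s = s ->
  (#|[set z | (bar z == z) && (t3 (z ^+ 2) == s)]|%:Z = (q ^ 2)%N%:Z - q%:Z * eta s)%R.
Proof.
move=> s0 hs; have [v hv] := cone_ex; have [v0 bv qv] := coneP _ hv.
set n := #|_|; have q2 := q_gt2 q4.
pose T z : nat := t3 (z ^+ 2) == s.
(* Both sides count the pairs (r, z) with t3 ((z + r v)^2) = s. For fixed r, translation is a
   bijection; for fixed z, the value is affine in r with slope 2 t3 (v z). *)
have e1 : (q * n = \sum_(r | fr r == r) \sum_(z | bar z == z) T (z + r * v)%R)%N.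
  transitivity (\sum_(r : K | fr r == r) n)%N.
    by rewrite sum_nat_const -cardsE card_fr.
  apply: eq_bigr => r /eqP hr; rewrite /n -sum_indicator.
  rewrite (reindex_inj (addIr (r * v))); apply: eq_bigl => z.
  by rewrite !rmorphD !rmorphM bv (fr_bar hr) (inj_eq (addIr _)).
have e2 z : bar z = z -> (\sum_(r | fr r == r) T (z + r * v)%R
   = if (t3 (v * z) == 0)%R then q * T z else 1)%N.
  move=> hz; have htz : fr (t3 (v * z)) = t3 (v * z) by rewrite t3_fr // !rmorphM hz bv.
  transitivity (\sum_(r | fr r == r) (t3 (z ^+ 2) + 2 * r * t3 (v * z) == s)%R)%N.
    by apply: eq_bigr => r /eqP hr; rewrite /T t3_sqD.
  case: ifP => [/eqP ->|/negbT t0].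
    under eq_bigr => r _ do rewrite mulr0 addr0.
    by rewrite sum_nat_const -cardsE card_fr.
  have hf x : fr x = x -> bar x = x by exact: fr_bar.
  have t20 : 2 * t3 (v * z) != 0 by rewrite mulf_neq0 ?two_neq0.
  have htz2 : fr (t3 (z ^+ 2)) = t3 (z ^+ 2) by rewrite t3_fr // !rmorphXn hz.
  rewrite sum_indicator (_ : [set r | _] = [set (s - t3 (z ^+ 2)) / (2 * t3 (v * z))])
    ?cards1 //.
  apply/setP => r; rewrite !inE -[RHS](inj_eq (mulIf t20)) divfK //.
  rewrite -[X in _ && X](inj_eq (addrI (- t3 (z ^+ 2)))) addKr.
  rewrite [_ * r * _]mulrAC [_ * r]mulrC [- _ + s]addrC andb_idl // => /eqP h.
  have -> : r = (s - t3 (z ^+ 2)) / (2 * t3 (v * z)) by rewrite -h mulfK.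
  by rewrite fmorph_div rmorphB rmorphM hs htz htz2 rmorph_nat.
move: e1; rewrite exchange_big /= (eq_bigr _ (fun z hz => e2 z (eqP hz))).
rewrite (bigID (fun z => t3 (v * z) == 0)) /=.
under eq_bigr => z /andP[_ ->] do [].
under [X in (_ + X)%N]eq_bigr => z /andP[_ /negbTE ->] do [].
rewrite -big_distrr /= sum1_card sum_indicator => e1.
have e3 := card_perp hv hs.
have e4 : (#|[set z | (bar z == z) && (t3 (v * z) == 0)]%R| = q ^ 2)%N.
  by rewrite card_E_fiber ?rmorph0.
have e5 : (#|[pred z | (bar z == z) && (t3 (v * z) != 0)]%R| = q ^ 3 - q ^ 2)%N.
  rewrite -(proj1 card_bar) -e4 -(cardsID [set z | t3 (v * z) == 0] [set x | bar x == x]).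
  rewrite (_ : _ :&: _ = [set z | (bar z == z) && (t3 (v * z) == 0)]);
    last by apply/setP => z; rewrite !inE.
  by rewrite addKn; apply: eq_card => z; rewrite !inE andbC.
move: e1; rewrite [X in (_ = _ + X)%N]e5.
rewrite (_ : #|_| = #|[set z | [&& bar z == z, t3 (v * z) == 0 & t3 (z ^+ 2) == s]]|);
  last first.
  by apply: eq_card => z; rewrite !inE andbA.
move=> e1; have : (q%:Z * n%:Z = q%:Z * ((q ^ 2)%N%:Z - q%:Z * eta s))%R.
  rewrite -PoszM e1 PoszD PoszM e3 etaN ?fr_bar // -subzn ?leq_exp2l //; last by lia.
  rewrite (expnS q 2) !PoszM; ring.
by apply: mulfI; lia.
Qed.

(** * Sums of the quadratic and quartic characters *)

Lemma sum_eta_t3 s : fr s = s ->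
  \sum_(c | (bar c == c) && (t3 c == s)) eta c = - q%:Z * eta s.
Proof.
move=> hs; have [->|s0] := eqVneq s 0; first by rewrite sum_eta_t30 eta0 mulr0.
have := sum_1eta (fun c => t3 c == s); rewrite (card_t3sq s0 hs) big_split /=.
rewrite sumr_const natz -cardsE (card_t3 hs) mulNr; exact: addrI.
Qed.

Lemma sum_eta_shift w : bar w = w ->
  \sum_(c | (bar c == c) && (t3 c == 0)) eta (w + c) = - q%:Z * eta (t3 w).
Proof.
move=> hw; rewrite -sum_eta_t3 ?t3_fr // [RHS](reindex_inj (addrI w)).
apply: eq_bigl => c; rewrite !rmorphD hw (inj_eq (addrI w)); congr (_ && _).
have -> : t3 (w + c) = t3 w + t3 c by rewrite /t3 !rmorphD; ring.
by rewrite -[X in _ = (_ == X)]addr0 (inj_eq (addrI _)).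
Qed.

Lemma antiE_ex : exists2 j : K, j != 0 & bar j = - j.
Proof.
have h : (#|[set x : K | bar x == x]| < #|[set: K]|)%N.
  rewrite (proj1 card_bar) cardsT cardK ltn_exp2l //; have := q_gt2 q4; lia.
have [x] : exists x, x \in [set: K] :\: [set x | bar x == x].
  by apply/set0Pn; rewrite -card_gt0 cardsD (setIidPr _) ?subsetT // subn_gt0.
rewrite !inE andbT => hx; exists (bar x - x); first by rewrite subr_eq0.
by rewrite !rmorphB fr6 opprB.
Qed.

(** The square roots j and - j of j^2 both lie outside F_(q^3). *)
Lemma eta_antiE j : j != 0 -> bar j = - j -> eta (j ^+ 2) = -1.
Proof.
move=> j0 hj; have hj2 : bar (j ^+ 2) = j ^+ 2 by rewrite !rmorphXn hj sqrrN.
have := card_sqrt hj2; rewrite /eta expf_eq0 (negbTE j0) /=; case: ifP => // _ h.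
have : (0 < #|[set v | (bar v == v) && (v ^+ 2 == j ^+ 2)]%R|)%N by rewrite -ltz_nat h.
case/card_gt0P => v; rewrite inE eqf_sqr => /andP[/eqP hv /orP[]/eqP e].
  by move: hj; rewrite -e hv => /eqP; rewrite e (negbTE (neqN j0)).
by move: hv; rewrite e !rmorphN hj => /eqP; rewrite opprK (negbTE (neqN j0)).
Qed.

(** Such z are c / 2 + (j / 2) d with d in F_(q^3) and d^2 = D / j^2, where D is the discriminant of
    X^2 - c X + w^2. As j^2 is a nonsquare, 1 + eta of the quotient is 1 - eta D. *)
Lemma card_norm_tr w c : bar w = w -> bar c = c ->
  (#|[set z | (z * bar z == w ^+ 2) && (z + bar z == c)]|%:Z
    = 1 - eta (c ^+ 2 - 4 * w ^+ 2))%R.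
Proof.
move=> hw hc; have [j j0 hj] := antiE_ex.
set D := c ^+ 2 - 4 * w ^+ 2; have hD : bar D = D by rewrite /D !(rmorphB, rmorphM,
  rmorphXn) hw hc !rmorph_nat.
have hj2 : bar (j ^+ 2) = j ^+ 2 by rewrite !rmorphXn hj sqrrN.
have hDj : bar (D / j ^+ 2) = D / j ^+ 2 by rewrite !fmorph_div hD hj2.
have -> : 1 - eta D = 1 + eta (D / j ^+ 2).
  have -> : eta D = eta (D / j ^+ 2) * eta (j ^+ 2) by rewrite -etaM ?divfK ?expf_neq0.
  by rewrite eta_antiE //; ring.
have t0 := two_neq0.
have f0 : 4 != 0 :> K by rewrite (_ : 4 = 2 * 2) ?mulf_neq0 //; ring.
have jt0 : j / 2 != 0 by rewrite mulf_neq0 ?invr_eq0.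
pose g d := c / 2 + j / 2 * d.
have gI : injective g by move=> d d' /addrI; exact: mulfI.
rewrite -card_sqrt // -[in RHS](card_imset _ gI); congr _%:Z; apply: eq_card => z.
rewrite inE; apply/andP/imsetP => [[/eqP nz /eqP tz]|[d]].
  exists ((z - bar z) / j); last by rewrite /g -tz; field; rewrite j0 t0.
  rewrite inE !fmorph_div !rmorphB fr6 hj -opprB mulNr invrN mulrN opprK eqxx /=.
  apply/eqP; rewrite exprMn exprVn; congr (_ / _); rewrite /D -nz -tz; ring.
rewrite inE => /andP[/eqP hd /eqP d2] ->.
have hb : bar (g d) = c / 2 - j / 2 * d.
  by rewrite /g !(rmorphD, rmorphM, fmorphV, rmorph_nat) hd hj hc; field; rewrite ?t0.
rewrite hb /g; split; apply/eqP; last by field; rewrite ?t0.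
transitivity ((c ^+ 2 - j ^+ 2 * d ^+ 2) / 4); first by field; rewrite ?t0 ?f0.
by rewrite d2 mulrC (mulrC (j ^+ 2)) divfK ?expf_neq0 // /D; field; rewrite ?t0 ?f0.
Qed.

(** Sorting by c = z + bar z gives the sum of (1 - eta (c^2 - 4 w^2)) * eta (2 w + c); since eta (2
    w + c) squares to 1, the second part becomes a sum of eta (c - 2 w). The translates are by
    opposite elements and [eta] is odd, so the two parts add up instead of cancelling. *)
Lemma sum_quartic_sign w : w != 0 -> bar w = w ->
  \sum_(z | (z * bar z == w ^+ 2) && (t3 (z + bar z) == 0)) quartic_sign z
  = - (2 * q%:Z) * (eta w * eta (2 * t3 w)).
Proof.
move=> w0 hw.
pose P z := (z * bar z == w ^+ 2) && (t3 (z + bar z) == 0).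
have t3w : fr (t3 w) = t3 w by rewrite t3_fr.
have h2w : bar (2 * w) = 2 * w by rewrite !rmorphM !rmorph_nat hw.
have t32 : t3 (2 * w) = 2 * t3 w by rewrite t3_Z // rmorph_nat.
(* At z = - w, which is in range exactly when t3 w = 0, [quartic_signE] fails: its right-hand side
   is 0, the sign is 1. The exceptional term c = - 2 w in [e3] makes up for this. *)
have e1 : \sum_(z | P z) quartic_sign z =
    eta w * (\sum_(z | P z) eta (2 * w + (z + bar z))) + (t3 w == 0)%:Z.
  have PN : P (- w) = (t3 w == 0).
    rewrite /P !rmorphN hw mulrNN -expr2 eqxx /= -opprD t3_N oppr_eq0 -mulr2n -mulr_natl
      t32.
    by rewrite mulf_eq0 (negbTE two_neq0).
  have X1 : quartic_sign (- w) = 1.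
    by rewrite /quartic_sign quartic1 ?eqxx ?oppr_eq0 // !rmorphN hw.
  have eN : eta (2 * w + (- w + bar (- w))) = 0.
    by rewrite !rmorphN hw (_ : 2 * w + _ = 0) ?eta0 //; ring.
  rewrite -PN mulr_sumr; case: (boolP (P (- w))) => hP.
    rewrite (bigD1 (- w)) //= [in RHS](bigD1 (- w)) //= X1 eN mulr0 add0r addrC;
      congr (_ + _).
    by apply: eq_bigr => z /andP[/andP[/eqP nz _] zw]; rewrite -quartic_signE.
  rewrite addr0; apply: eq_bigr => z Pz; have /andP[/eqP nz _] := Pz;
    rewrite -quartic_signE //.
  by apply: contraNneq hP => <-.
have hc0 c : bar c = c -> bar (2 * w + c) = 2 * w + c.
  by move=> hc; rewrite !rmorphD hc h2w.
have e2 : \sum_(z | P z) eta (2 * w + (z + bar z)) =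
    \sum_(c | (bar c == c) && (t3 c == 0)) (1 - eta (c ^+ 2 - 4 * w ^+ 2)) * eta (2 * w +
      c).
  rewrite (partition_big (fun z => z + bar z) (fun c => (bar c == c) && (t3 c == 0))) /=.
    apply: eq_bigr => c /andP[/eqP hc /eqP tc].
    rewrite -card_norm_tr // -natz -sumr_const mulr_suml.
    apply: eq_big => [z|z /andP[_ /eqP ->]]; last by rewrite mul1r.
    by rewrite inE /P; case: (eqVneq (z + bar z) c) => [->|];
      rewrite ?andbF // tc eqxx !andbT.
  by move=> z /andP[_ ->]; rewrite trE eqxx.
have e3 : \sum_(c | (bar c == c) && (t3 c == 0)) eta (c ^+ 2 - 4 * w ^+ 2) * eta (2 * w + c)
   = \sum_(c | (bar c == c) && (t3 c == 0)) eta (c - 2 * w) + (t3 w == 0)%:Z * eta w.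
  have PN : ((bar (- (2 * w)) == - (2 * w)) && (t3 (- (2 * w)) == 0)) = (t3 w == 0).
    by rewrite !rmorphN h2w eqxx t3_N oppr_eq0 t32 mulf_eq0 (negbTE two_neq0).
  have fac c : c ^+ 2 - 4 * w ^+ 2 = (c - 2 * w) * (2 * w + c) by ring.
  have main c : bar c = c -> 2 * w + c != 0 ->
     eta (c ^+ 2 - 4 * w ^+ 2) * eta (2 * w + c) = eta (c - 2 * w).
    move=> hc c0; rewrite fac etaM ?hc0 // ?rmorphB ?rmorphB ?rmorphB ?h2w ?hc //.
    by rewrite -mulrA eta_sqr ?mulr1.
  rewrite -PN; case: (boolP (_ && _)) => hP.
    rewrite (bigD1 (- (2 * w))) //= [in RHS](bigD1 (- (2 * w))) //=.
    rewrite subrr eta0 mulr0 add0r (_ : - (2 * w) - 2 * w = - (2 ^+ 2 * w)); last by ring.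
    have -> : eta (- (2 ^+ 2 * w)) = - eta w.
      have b2 : bar 2 = 2 by rewrite !rmorph_nat.
      have b22 : bar (2 ^+ 2) = 2 ^+ 2 by rewrite !rmorphXn b2.
      have b22w : bar (2 ^+ 2 * w) = 2 ^+ 2 * w by rewrite 3!rmorphM b22 hw.
      by rewrite (etaN b22w) (etaM b22 hw) eta_sqE ?two_neq0 // mul1r.
    rewrite mul1r addrAC addNr add0r; apply: eq_bigr => c /andP[/andP[/eqP hc _] cw].
    by rewrite main // addrC addr_eq0.
  rewrite mul0r addr0; apply: eq_bigr => c Pc; have /andP[/eqP hc _] := Pc; rewrite main //.
  by apply: contraNneq hP => /eqP; rewrite addrC addr_eq0 => /eqP <-.
have e4 : \sum_(c | (bar c == c) && (t3 c == 0)) eta (c - 2 * w) = q%:Z * eta (2 * t3 w).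
  under eq_bigr => c _ do rewrite addrC.
  by rewrite sum_eta_shift ?rmorphN ?rmorphN ?rmorphN ?h2w // t3_N etaN ?t32 ?mulrNN //
    !rmorphM !rmorph_nat !t3w.
rewrite e1 e2 (eq_bigr (fun c => eta (2 * w + c) - eta (c ^+ 2 - 4 * w ^+ 2) * eta (2 * w
  + c))); last first.
  by move=> c _; ring.
rewrite sumrB e3 e4 sum_eta_shift // t32.
have := eta_sqr w0; case: (t3 w == 0) => /= hh; last by ring.
transitivity (- (2 * q%:Z) * (eta w * eta (2 * t3 w)) + (1 - eta w * eta w)); first by ring.
by rewrite hh subrr addr0.
Qed.

(* The Gram determinant of the trace form is the square of a determinant. *)
Lemma t3_gram v1 v2 v3 : bar v1 = v1 -> bar v2 = v2 -> bar v3 = v3 ->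
  t3 (v1 ^+ 2) = 0 -> t3 (v2 ^+ 2) = 0 -> t3 (v3 ^+ 2) = 0 ->
  t3 (v1 * cr v2 v3) ^+ 2 = 2 * (t3 (v1 * v2) * t3 (v1 * v3) * t3 (v2 * v3)).
Proof.
move=> h1 h2 h3 q1 q2 q3.
transitivity (2 * (t3 (v1 * v2) * t3 (v1 * v3) * t3 (v2 * v3))
   + t3 (v1 ^+ 2) * t3 (v2 ^+ 2) * t3 (v3 ^+ 2) - t3 (v1 ^+ 2) * t3 (v2 * v3) ^+ 2
   - t3 (v2 ^+ 2) * t3 (v1 * v3) ^+ 2 - t3 (v3 ^+ 2) * t3 (v1 * v2) ^+ 2); last first.
  by rewrite q1 q2 q3; ring.
rewrite /t3 /cr !(rmorphB, rmorphM, rmorphXn) h2 h3.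
move: (fr (fr v1)) (fr (fr v2)) (fr (fr v3)) (fr v1) (fr v2) (fr v3) => *; ring.
Qed.

(** By [t3_gram], twice the product of the three values is a nonzero square. This is what lets one
    base point divide the cone into two halves consistently. *)
Lemma eta_cone3 v1 v2 v3 : cone v1 -> cone v2 -> cone v3 ->
  t3 (v1 * v2) != 0 -> t3 (v1 * v3) != 0 -> t3 (v2 * v3) != 0 ->
  eta (t3 (v1 * v2)) * eta (t3 (v1 * v3)) * eta (t3 (v2 * v3)) = eta 2.
Proof.
move=> /coneP[_ h1 q1] /coneP[_ h2 q2] /coneP[_ h3 q3] a0 b0 c0.
have ht u : bar u = u -> bar (t3 u) = t3 u by move=> hu; apply/fr_bar/t3_fr.
have hM u v : bar u = u -> bar v = v -> bar (u * v) = u * v by move=> hu hv;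
  rewrite 3!rmorphM hu hv.
have := t3_gram h1 h2 h3 q1 q2 q3; set D := t3 _ => eD.
have D0 : D != 0 by rewrite -sqrf_eq0 eD !mulf_neq0 // two_neq0.
have hD : bar D = D.
  by apply: ht; apply: hM => //; rewrite /cr !(rmorphB, rmorphM) h2 h3.
have := eta_sqE D0 hD; rewrite eD !etaM ?ht ?hM ?rmorph_nat //; rewrite ?ht ?hM //.
have := eta_sqr two_neq0; set e := eta 2; set x := _ * _ * _ => e2 ex.
by rewrite -[x]mul1r -e2 -mulrA ex mulr1.
Qed.

Section Signs.

Variable vs : K.
Hypothesis hvs : cone vs.

(* The two halves of the quadratic cone t3 (v^2) = 0: on distinct points in the
   same half, t3 (v w) lies in the square class of 2. *)
Definition cone_sign v : int :=
  if t3 (vs * v) == 0 then eta (v / vs) else eta 2 * eta (t3 (vs * v)).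

Lemma cone_sign_sqr v : cone v -> cone_sign v * cone_sign v = 1.
Proof.
move=> hv; have [v0 _ _] := coneP _ hv; have [vs0 _ _] := coneP _ hvs.
rewrite /cone_sign; case: ifP => [_|/negbT t0];
  first by rewrite eta_sqr // mulf_neq0 ?invr_eq0.
by rewrite mulrACA !eta_sqr ?two_neq0.
Qed.

Lemma cone_Z r v : r != 0 -> fr r = r -> cone v -> cone (r * v).
Proof.
move=> r0 hr /coneP[v0 hv qv]; apply/coneP; split; first exact: mulf_neq0.
  by rewrite 3!rmorphM hv !hr.
by rewrite exprMn t3_Z ?rmorphXn ?hr // qv mulr0.
Qed.

Lemma cone_signZ r v : r != 0 -> fr r = r -> cone v -> cone_sign (r * v) = eta r *
  cone_sign v.
Proof.
move=> r0 hr hv; have [v0 bv _] := coneP _ hv; have [vs0 bvs _] := coneP _ hvs.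
have e : t3 (vs * (r * v)) = r * t3 (vs * v) by rewrite (mulrCA vs r v) (t3_Z (vs * v) hr).
rewrite /cone_sign e mulf_eq0 (negbTE r0) /=; case: ifP => _.
  by rewrite -mulrA (etaM (fr_bar hr)) // !fmorph_div bv bvs.
rewrite (etaM (fr_bar hr)) 1?mulrCA //.
by apply/fr_bar/t3_fr; rewrite 3!rmorphM bv bvs.
Qed.

(** With v and w off F_q vs this is [eta_cone3] for vs, v, w. If one of them is r vs ([aux]), the
    character of r enters through its sign and through t3 (v w), hence squared. *)
Lemma cone_signM v w : cone v -> cone w -> t3 (v * w) != 0 ->
  cone_sign v * cone_sign w * eta (t3 (v * w)) = eta 2.
Proof.
move=> hv hw vw; have [v0 bv _] := coneP _ hv; have [vs0 bvs _] := coneP _ hvs.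
have [w0 bw _] := coneP _ hw.
have htt x y : bar x = x -> bar y = y -> bar (t3 (x * y)) = t3 (x * y).
  by move=> hx hy; apply/fr_bar/t3_fr; rewrite 3!rmorphM hx hy.
have aux x y : cone x -> cone y -> t3 (vs * x) = 0 -> t3 (x * y) != 0 ->
    cone_sign x * cone_sign y * eta (t3 (x * y)) = eta 2.
  move=> hx hy tx xy; have [x0 bx _] := coneP _ hx; have [y0 by' _] := coneP _ hy.
  have hr := cone_prop hvs hx tx; set r := x / vs in hr.
  have ex : x = r * vs by rewrite divfK.
  have r0 : r != 0 by rewrite mulf_neq0 ?invr_eq0.
  have e1 : t3 (x * y) = r * t3 (vs * y) by rewrite {1}ex -mulrA t3_Z.
  have ty : t3 (vs * y) != 0 by apply: contraNneq xy => h; rewrite e1 h mulr0.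
  rewrite e1 (etaM (fr_bar hr) (htt _ _ bvs by')) /cone_sign tx eqxx (negbTE ty) -/r.
  have := eta_sqr r0; have := eta_sqr ty; set a := eta r; set b := eta _ => hb ha.
  transitivity (eta 2 * (a * a) * (b * b)); first by ring.
  by rewrite ha hb !mulr1.
have [tv|tv] := eqVneq (t3 (vs * v)) 0; first exact: aux.
have [tw|tw] := eqVneq (t3 (vs * w)) 0.
  by rewrite [cone_sign v * _]mulrC [v * w]mulrC; apply: aux => //; rewrite mulrC.
rewrite /cone_sign (negbTE tv) (negbTE tw) -[RHS](eta_cone3 hvs hv hw) //.
move: (eta (t3 (vs * v))) (eta (t3 (vs * w))) (eta (t3 (v * w))) => a b c.
transitivity ((eta 2 * eta 2) * (a * b * c)); first by ring.
by rewrite eta_sqr ?two_neq0 // mul1r.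
Qed.

Lemma cone_fr v : cone v -> cone (fr v).
Proof.
move=> /coneP[v0 hv qv]; apply/coneP; rewrite fmorph_eq0 hv; split=> //.
by rewrite -(rmorph0 fr) -qv /t3 !rmorphXn !rmorphD !rmorphXn.
Qed.

(** The pairs (v, fr v) and (fr v, fr2 v) have the same value of the trace form, so [cone_signM]
    relates the sign of [fr v] to both ends in the same way. If v and fr v are dependent, their
    ratio is a cube root of 1 in F_q, hence a square. *)
Lemma cone_sign_fr2 v : cone v -> cone_sign (fr2 v) = cone_sign v.
Proof.
move=> hv; have [v0 bv _] := coneP _ hv.
have [tv|tv] := eqVneq (t3 (v * fr v)) 0.
  have hr := cone_prop hv (cone_fr hv) tv; set r := fr v / v in hr.
  have ev : fr v = r * v by rewrite divfK.
  have r0 : r != 0 by rewrite mulf_neq0 ?invr_eq0 ?fmorph_eq0.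
  clearbody r.
  have r3 : r ^+ 3 = 1.
    apply: (mulIf v0); rewrite mul1r -[RHS]bv.
    by rewrite !(ev, rmorphM, hr); ring.
  have er : eta r = 1.
    have hb := fr_bar hr; have hb2 : bar (r ^+ 2) = r ^+ 2 by rewrite !rmorphXn hb.
    have : eta r * eta (r ^+ 2) = 1 by rewrite -etaM // -exprS r3 eta1.
    by rewrite eta_sqE // mulr1.
  have hz w : cone w -> cone_sign (r * w) = cone_sign w by move=> hw;
    rewrite cone_signZ // er mul1r.
  by rewrite !(ev, rmorphM, hr) !hz //; apply: cone_Z.
have hf := cone_fr hv; have hf2 := cone_fr hf.
have e : t3 (fr v * fr2 v) = t3 (v * fr v).
  rewrite -(@t3_fr (v * fr v)); last by rewrite 3!rmorphM bv.
  by rewrite /t3 !rmorphD !rmorphM.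
have h1 := cone_signM hv hf tv; have tv' := tv; rewrite -e in tv'.
have := cone_signM hf hf2 tv'; rewrite e -h1.
move/(mulIf _); rewrite eta_eq0 => /(_ tv); rewrite mulrC; apply: mulIf.
by apply: contra_eq_neq (cone_sign_sqr hf) => ->.
Qed.

(** * The sign of a singular point and its eigenvalue equation *)

Definition i0 : K := odflt 1 [pick i | i ^+ 2 == -1].
(** One representative of each pair {c, - c} of fourth roots of unity; what counts is that the
    function is odd with values 1 and -1. The default in [i0] is harmless: [quartic_halfN] needs
    i0^2 = -1 only when its own c is such a root. *)
Definition quartic_half (c : K) : int := if (c == 1) || (c == i0) then 1 else -1.

Lemma quartic_halfN c : c ^+ 4 = 1 -> quartic_half (- c) = - quartic_half c.
Proof.
have n1 := oneN1.
move=> quartic; have : (c ^+ 2) ^+ 2 == 1 by rewrite -exprM quartic.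
rewrite sqrf_eq1 => /orP[/eqP c2|c2].
  have ni0 : (-1 == i0) = false.
    rewrite /i0; case: pickP => [i /= /eqP hi|_ /=] //; apply/eqP => e.
    by move: n1; rewrite -{1}hi -e sqrrN expr1n eqxx.
  have /eqP := c2; rewrite sqrf_eq1 /quartic_half => /orP[]/eqP->;
    rewrite ?opprK eqxx n1 ni0 //=.
have hi : i0 ^+ 2 == -1.
  by rewrite /i0; case: pickP => [i //|/(_ c)]; rewrite c2.
have cn1 (d : K) : d ^+ 2 == -1 -> (d == 1) = false.
  by move=> hd; apply/eqP => e; move: hd; rewrite e expr1n eq_sym n1.
have i00 : i0 != 0 by apply: contraTneq hi => ->; rewrite expr0n eq_sym oppr_eq0 oner_eq0.
move: c2; rewrite -(eqP hi) eqf_sqr /quartic_half => /orP[]/eqP->;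
  rewrite ?opprK !cn1 ?sqrrN //=;
by rewrite eqxx eq_sym (negbTE (neqN i00)).
Qed.

Lemma quartic_half_sqr c : quartic_half c * quartic_half c = 1.
Proof. by rewrite /quartic_half; case: ifP. Qed.

(* The sign whose positive points are the lines of the hemisystem. *)
Definition hsign x := cone_sign (pm_sqrt (x * bar x)) * eta (pm_sqrt (x * bar x)) *
  quartic_half (quartic x).

Definition quadric x := (x != 0) && (t3 (x * bar x) == 0).
Definition polar x y := t3 (bar x * y + x * bar y).

Lemma quadricP x : reflect (x != 0 /\ t3 (x * bar x) = 0) (quadric x).
Proof. by apply: (iffP andP) => -[h1 h2]; split=> //; apply/eqP. Qed.

Lemma norm_neq0 x : x != 0 -> x * bar x != 0.
Proof. by move=> x0; rewrite mulf_neq0 ?fmorph_eq0. Qed.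

Lemma etaE u : u != 0 -> bar u = u -> (eta u)%:~R = u ^+ (2 * m + 1).
Proof.
move=> u0 hu; rewrite /eta (negbTE u0); case: (euler u0 hu) => ->; first by rewrite eqxx.
by rewrite oneN1 rmorphN1.
Qed.

Lemma quartic_sqr x : x != 0 -> quartic x ^+ 2 = (eta (x * bar x))%:~R.
Proof. by move=> x0; rewrite quartic_euler // etaE ?norm_neq0 ?normE. Qed.

Lemma eta_signP u : u != 0 -> eta u = 1 \/ eta u = -1.
Proof. by move=> u0; rewrite /eta (negbTE u0); case: ifP; [left | right]. Qed.

Lemma quartic_exp4 x : x != 0 -> quartic x ^+ 4 = 1.
Proof.
move=> x0; rewrite (exprM _ 2 2) quartic_sqr // -rmorphXn expr2 eta_sqr ?norm_neq0 //.
Qed.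

Lemma quartic_bar x : x != 0 -> quartic (bar x) * quartic x = 1.
Proof. by move=> x0; rewrite -quarticM mulrC quartic1 ?norm_neq0 ?normE. Qed.

Lemma quadric_cone x : quadric x -> cone (pm_sqrt (x * bar x)).
Proof.
move=> /quadricP[x0 qx]; apply/coneP;
  rewrite pm_sqrt_eq0 norm_neq0 // pm_sqrt_bar ?normE //.
split=> //; rewrite pm_sqrt_sqr ?normE // t3_Z ?qx ?mulr0 //.
by rewrite rmorph_int.
Qed.

Lemma sum_anti (P : pred K) (h : K -> K) (g : K -> int) :
  (forall y, P y -> P (h y) /\ h (h y) = y) -> (forall y, P y -> g (h y) = - g y) ->
  \sum_(y | P y) g y = 0.
Proof.
move=> hP hg; have : \sum_(y | P y) g y = - \sum_(y | P y) g y.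
  rewrite {1}(reindex_onto h h) /= => [|y Py]; last by case: (hP y Py).
  rewrite -sumrN; apply: eq_big => y; last first.
    by move=> /andP[Phy /eqP hy]; have [] := hP _ Phy; rewrite hy => Py _; rewrite hg.
  apply/andP/idP => [[Phy /eqP hy]|Py]; first by case: (hP _ Phy); rewrite hy.
  by have [-> ->] := hP _ Py.
lia.
Qed.

(** In terms of z = bar x * y the map is z |-> bar z. It keeps the norm of y and sends [quartic y]
    to the square of [quartic x] divided by [quartic y]; that is - quartic y, because the two
    squares are opposite. *)
Lemma hsign_anti x y : x != 0 -> y != 0 -> eta (y * bar y) != eta (x * bar x) ->
  hsign (x * bar y / bar x) = - hsign y.
Proof.
move=> x0 y0 hxy; set y' := _ / _.
have bx0 : bar x != 0 by rewrite !fmorph_eq0.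
have eN : y' * bar y' = y * bar y.
  by rewrite /y' fmorph_div fmorph_div fmorph_div !rmorphM !fr6; field; rewrite x0.
have ec : quartic y' = - quartic y.
  have c0 z : z != 0 -> quartic z != 0.
    by move=> z0; apply: contra_eq_neq (quartic_exp4 z0) => ->;
      rewrite expr0n eq_sym oner_neq0.
  apply: (mulIf (c0 _ y0)); apply: (mulIf (c0 _ bx0)).
  have -> : quartic y' * quartic y * quartic (bar x) = quartic x * (quartic (bar y) *
    quartic y).
    by rewrite mulrAC -(quarticM y' (bar x)) /y' divfK // quarticM mulrA.
  rewrite quartic_bar // mulr1 mulNr -expr2 quartic_sqr // mulNr.
  have -> : eta (y * bar y) = - eta (x * bar x).
    by move: hxy; case: (eta_signP (norm_neq0 y0)) => ->;
      case: (eta_signP (norm_neq0 x0)) => ->.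
  rewrite mulrNz mulNr opprK -quartic_sqr // expr2 -mulrA [X in _ = _ * X]mulrC
    quartic_bar //.
  by rewrite mulr1.
by rewrite /hsign eN ec quartic_halfN ?quartic_exp4 // mulrN.
Qed.

(** Both factors are odd in v because -1 is a nonsquare; this frees [hsign] from the choice of root
    made by [pm_sqrt]. *)
Lemma cone_sign_eta_opp v w : cone v -> w = v \/ w = - v -> cone_sign w * eta w =
  cone_sign v * eta v.
Proof.
move=> hv [->//|->]; have [v0 bv _] := coneP _ hv.
rewrite -mulN1r cone_signZ ?oppr_eq0 ?oner_eq0 ?rmorphN1 // etaM ?rmorphN1 ?rmorphN1
  ?rmorphN1 //.
by rewrite etaN1; ring.
Qed.

Lemma cone_perp_card v : cone v ->
  #|[set w | cone w && (t3 (v * w) == 0)]| = (q - 1)%N.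
Proof.
move=> hv; have [v0 bv qv] := coneP _ hv.
rewrite -card_fr (cardsD1 0 [set x : K | fr x == x]) inE rmorph0 eqxx addnC addnK.
rewrite -[in RHS](card_imset _ (mulIf v0)); apply: eq_card => w.
rewrite inE; apply/andP/imsetP => [[hw /eqP vw]|[r]].
  exists (w / v); last by rewrite divfK.
  have [w0 _ _] := coneP _ hw.
  by rewrite !inE mulf_neq0 ?invr_eq0 //=; apply/eqP/cone_prop.
rewrite !inE => /andP[r0 /eqP hr] ->; split; first exact: cone_Z.
by rewrite mulrCA t3_Z // -expr2 qv mulr0.
Qed.

(* Points y with eta (N y) <> eta (N x) cancel in pairs.  For the others, set
   z = bar x * y and sort by the square root v of N y up to sign: the sums
   over z are given by sum_quartic_sign, and cone_signM makes all their
   contributions equal, except that the points of F_q v_x contribute 0. *)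
Theorem hsign_eigen x : quadric x ->
  \sum_(y | quadric y && (polar x y == 0)) hsign y = - ((q ^ 2)%:Z * (q%:Z - 1)) * hsign x.
Proof.
move=> hx; have [x0 qx] := quadricP _ hx; set a := eta (x * bar x).
have bx0 : bar x != 0 by rewrite !fmorph_eq0.
rewrite (bigID (fun y => eta (y * bar y) == a)) /= [X in _ + X](@sum_anti _ (fun y =>
  x * bar y / bar x)); last 2 first.
- move=> y /andP[/andP[/quadricP[y0 qy] /eqP pxy] ya].
  have eN : (x * bar y / bar x) * bar (x * bar y / bar x) = y * bar y.
    by rewrite !(rmorphM, fmorphV) !fr6; field; rewrite bx0 x0.
  split; last by rewrite !(rmorphM, fmorphV) !fr6; field; rewrite bx0 x0.
  apply/andP; split; last by rewrite eN.
  apply/andP; split.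
    by apply/quadricP; rewrite eN; split; rewrite ?mulf_neq0 ?invr_eq0 ?fmorph_eq0.
  by rewrite -pxy /polar; apply/eqP; congr t3; rewrite !(rmorphM, fmorphV) !fr6; field;
    rewrite bx0 x0.
- by move=> y /andP[/andP[/quadricP[y0 qy] _] ya]; apply: hsign_anti.
(* Both sides are doubled so that each y can be counted for both square roots v and - v of a * N
   y. *)
rewrite addr0; apply: (@mulfI _ 2) => //.
have a2 : (a%:~R : K) * a%:~R = 1 by rewrite -rmorphM /a eta_sqr ?norm_neq0.
have bara : bar (a%:~R) = a%:~R by rewrite !rmorph_int.
have etaa : eta (a%:~R) = a.
  rewrite /a; case: (eta_signP (norm_neq0 x0)) => ->; first by rewrite rmorph1 eta1.
  by rewrite rmorphN1 etaN1.
set vx := pm_sqrt (x * bar x); have cvx : cone vx := quadric_cone hx.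
have [vx0 bvx qvx] := coneP _ cvx.
have Nx : x * bar x = a%:~R * vx ^+ 2 by rewrite /vx pm_sqrt_sqr ?normE // mulrA a2 mul1r.
transitivity (\sum_(v | cone v) \sum_(y | (y * bar y == a%:~R * v ^+ 2) && (polar x y ==
  0)) hsign y).
  rewrite (exchange_big_dep (fun y => quadric y && (polar x y == 0) && (eta (y * bar y)
    == a))) /=; last first.
    move=> v y /coneP[v0 bv qv] /andP[/eqP hN ->]; rewrite andbT; apply/andP; split.
      apply/quadricP; split; last by rewrite hN t3_Z ?qv ?mulr0 // rmorph_int.
      apply: contra_neq v0 => y0; apply/eqP;
        rewrite -sqrf_eq0 -[v ^+ 2]mul1r -a2 -mulrA -hN y0.
      by rewrite mul0r mulr0.
    have bv2 : bar (v ^+ 2) = v ^+ 2 by rewrite !rmorphXn bv.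
    by rewrite hN etaM // eta_sqE // mulr1 etaa.
  rewrite mulr_sumr; apply: eq_bigr => y /andP[/andP[qy py] /eqP ya].
  have [y0 qy'] := quadricP _ qy; have cvy := quadric_cone qy.
  rewrite sumr_const -[RHS]mulr_natl; congr (_ * _).
  have bN : bar (a%:~R * (y * bar y)) = a%:~R * (y * bar y) by rewrite 3!rmorphM bara normE.
  have [rt0 brt _] := coneP _ cvy.
  have e1 : eta (a%:~R * (y * bar y)) = 1.
    by rewrite -ya -pm_sqrt_sqr ?normE // eta_sqE.
  have := card_sqrt bN; rewrite e1 natz => h; rewrite -[LHS]/(1 + 1) -h; congr _%:Z;
    rewrite -cardsE; apply: eq_card => v.
  rewrite !inE [RHS]unfold_in py andbT;
    apply/andP/andP => [[/eqP bv /eqP v2]|[/coneP[v0 bv qv] /eqP hN]].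
    rewrite v2 mulrA a2 mul1r eqxx; split=> //; apply/coneP; split=> //.
      by rewrite -sqrf_eq0 v2 -ya -pm_sqrt_sqr ?normE // sqrf_eq0.
    by rewrite v2 t3_Z ?rmorph_int // qy' mulr0.
  by rewrite bv eqxx hN mulrA a2 mul1r eqxx.
have inner v : cone v ->
   \sum_(y | (y * bar y == a%:~R * v ^+ 2) && (polar x y == 0)) hsign y
   = - (2 * q%:Z) * hsign x * (t3 (vx * v) != 0)%:Z.
  move=> cv; have [v0 bv qv] := coneP _ cv.
  pose w := vx * v; have w0 : w != 0 by rewrite mulf_neq0.
  have bw : bar w = w by rewrite 3!rmorphM bvx bv.
  have hb z : z != 0 -> z / bar x != 0 by move=> z0; rewrite mulf_neq0 ?invr_eq0.
  rewrite (reindex_inj (mulIf (invr_neq0 bx0))) /=.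
  transitivity (\sum_(z | (z * bar z == w ^+ 2) && (t3 (z + bar z) == 0)) (cone_sign v *
    eta v * quartic_half (quartic x)) * quartic_sign z).
    apply: eq_big => z.
      have -> : polar x (z / bar x) = t3 (z + bar z).
        by congr t3; rewrite !(rmorphM, fmorphV) !fr6; field; rewrite bx0 x0.
      congr (_ && _).
      have -> : (z / bar x) * bar (z / bar x) = (z * bar z) / (x * bar x).
        by rewrite !(rmorphM, fmorphV) !fr6; field; rewrite bx0 x0.
      rewrite -(inj_eq (mulIf (norm_neq0 x0))) divfK ?norm_neq0 // [in X in _ == X]Nx.
      congr (_ == _). transitivity ((a%:~R * a%:~R) * w ^+ 2); last by rewrite a2 mul1r.
      by rewrite /w; ring.
    move=> /andP[/eqP hN _].
    have z0 : z != 0.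
      apply: contra_neq v0 => z0; apply/eqP;
        rewrite -sqrf_eq0 -[v ^+ 2]mul1r -a2 -mulrA -hN z0.
      by rewrite !mul0r mulr0.
    have y0 := hb _ z0; set y := z / bar x in hN y0 *.
    have Ey : eta (y * bar y) = a.
      have bv2 : bar (v ^+ 2) = v ^+ 2 by rewrite !rmorphXn bv.
      by rewrite hN etaM // eta_sqE // mulr1.
    have rv : pm_sqrt (y * bar y) = v \/ pm_sqrt (y * bar y) = - v.
      have : pm_sqrt (y * bar y) ^+ 2 == v ^+ 2 by rewrite pm_sqrt_sqr ?normE // Ey hN
        mulrA a2 mul1r.
      by rewrite eqf_sqr => /orP[/eqP|/eqP]; [left|right].
    rewrite /hsign (cone_sign_eta_opp cv rv) -!mulrA; congr (_ * (_ * _)).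
    have cz : quartic z = 1 \/ quartic z = -1.
      have : quartic z ^+ 2 == 1.
        rewrite quartic_sqr // (_ : z * bar z = (x * bar x) * (y * bar y)); last first.
          by rewrite /y !(rmorphM, fmorphV) !fr6; field; rewrite bx0 x0.
        rewrite Nx hN.
        have bvv u : bar u = u -> u != 0 -> eta (u ^+ 2) = 1 by move=> *; exact: eta_sqE.
        have -> : a%:~R * vx ^+ 2 * (a%:~R * v ^+ 2) = (a%:~R * a%:~R) * w ^+ 2 by
          rewrite /w; ring.
        by rewrite a2 mul1r bvv.
      by rewrite sqrf_eq1 => /orP[/eqP|/eqP]; [left|right].
    have -> : quartic y = quartic z * quartic x.
      have c0 : quartic (bar x) != 0.
        by apply: contra_eq_neq (quartic_bar x0) => ->; rewrite mul0r eq_sym oner_neq0.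
      by apply: (mulIf c0); rewrite -(quarticM y (bar x)) /y divfK // -mulrA [quartic x *
        _]mulrC quartic_bar // mulr1.
    rewrite /quartic_sign; case: cz => ->; rewrite ?mul1r ?eqxx ?mulr1 //.
    by rewrite oneN1 mulN1r quartic_halfN ?quartic_exp4 // mulrN1.
  rewrite -mulr_sumr sum_quartic_sign // {1}/w.
  have t3b : fr (t3 w) = t3 w by rewrite t3_fr.
  rewrite (etaM bvx bv) (@etaM 2 (t3 w)) ?(fr_bar t3b) ?rmorph_nat // -/w.
  rewrite /hsign -/vx; have := eta_sqr v0; have := eta_sqr vx0; have := cone_sign_sqr cvx.
  have [t0|t0] := eqVneq (t3 w) 0; first by rewrite t0 eta0 /=; move=> *; ring.
  (* This replaces the sign of v by those of vx, 2 and t3 w, after which all that depends on v is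
     squared away. *)
  have := cone_signM cvx cv t0; have := eta_sqr two_neq0.
  move: (eta vx) (eta v) (cone_sign vx) (cone_sign v) (eta 2) (eta (t3 w)) (quartic_half
    _) => e1 e2 s1 s2 e t s he hs h1 h2 h3 /=.
  rewrite -[LHS]mulr1 -[X in _ * X = _]h1.
  transitivity (- (2 * q%:Z) * (s1 * e1 * s) * (e2 * e2) * ((s1 * s2 * t) * e));
    first by ring.
  rewrite h3 hs he; ring.
rewrite (eq_bigr _ inner) -mulr_sumr.
(* Off F_q vx there are (q^2 - 1) - (q - 1) points of the cone; times - 2 q this is twice the
   eigenvalue. *)
have -> : \sum_(v | cone v) ((t3 (vx * v) != 0)%:Z : int) = (q ^ 2)%:Z - q%:Z.
  have h1 := cone_perp_card cvx; have h2 := card_cone; have q2 := q_gt2 q4.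
  have h3 : (#|[set v | cone v]| = #|[set v | cone v && (t3 (vx * v) == 0)]%R|
     + #|[set v | cone v && (t3 (vx * v) != 0)]%R|)%N.
    rewrite -(cardsID [set v | t3 (vx * v) == 0] [set v | cone v]).
    by congr (_ + _)%N; apply: eq_card => v; rewrite !inE // andbC.
  have -> : \sum_(v | cone v) ((t3 (vx * v) != 0)%:Z : int) = #|[set v | cone v && (t3
    (vx * v) != 0)]|%:Z.
    rewrite -sum_indicator; apply/esym; rewrite -natz natr_sum; apply: eq_bigr => v _;
      exact: natz.
  lia.
by rewrite expnS expn1 PoszM; ring.
Qed.

Lemma hsign_signP x : quadric x -> hsign x = 1 \/ hsign x = -1.
Proof.
move=> qx; have cx := quadric_cone qx; have [v0 _ _] := coneP _ cx.
have /eqP : hsign x ^+ 2 = 1.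
  rewrite /hsign expr2; move: (cone_sign_sqr cx) (eta_sqr v0) (quartic_half_sqr (quartic
    x)).
  move: (cone_sign _) (eta _) (quartic_half _) => a b c ha hb hc.
  transitivity ((a * a) * (b * b) * (c * c)); first by ring.
  by rewrite ha hb hc.
by rewrite sqrf_eq1 => /orP[/eqP|/eqP]; [left|right].
Qed.

Lemma quadric_Z z x : z != 0 -> fr (z * bar z) = z * bar z -> quadric x -> quadric (z * x).
Proof.
move=> z0 hz /quadricP[x0 qx]; apply/quadricP; split; first exact: mulf_neq0.
by rewrite 3!rmorphM mulrACA t3_Z // qx mulr0.
Qed.

(** The norm of z is in F_q, hence so is its [pm_sqrt] t, and the character of t comes out of both
    [cone_sign] and [eta]. *)
Lemma hsign_Z z x : z != 0 -> fr (z * bar z) = z * bar z -> quartic z = 1 -> quadric x ->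
  hsign (z * x) = hsign x.
Proof.
move=> z0 hz c4z qx; have cx := quadric_cone qx; have [v0 bv _] := coneP _ cx.
have nz0 := norm_neq0 z0.
rewrite /hsign quarticM c4z mul1r (_ : z * x * _ = (z * bar z) * (x * bar x)); last first.
  by rewrite 3!rmorphM mulrACA.
rewrite pm_sqrtM; set t := pm_sqrt (z * bar z); have t0 : t != 0 by rewrite pm_sqrt_eq0.
have ht : fr t = t by rewrite /t -pm_sqrt_fr hz.
congr (_ * _); rewrite cone_signZ // (etaM (fr_bar ht) bv) mulrACA.
by rewrite eta_sqr // mul1r.
Qed.

Lemma quadric_fr2 x : quadric x -> quadric (fr2 x).
Proof.
move=> /quadricP[x0 qx]; apply/quadricP; rewrite !fmorph_eq0; split=> //.
transitivity (fr2 (t3 (x * bar x))); last by rewrite qx !rmorph0.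
by rewrite /t3 !rmorphD !rmorphM.
Qed.

(** [fr2] raises the fourth root of unity [quartic x] to the power q^2 = 1 mod 4; [fr] alone would
    invert it. *)
Lemma hsign_fr2 x : quadric x -> hsign (fr2 x) = hsign x.
Proof.
move=> qx; have cx := quadric_cone qx; have [x0 _] := quadricP _ qx.
rewrite /hsign -!rmorphM !pm_sqrt_fr cone_sign_fr2 // !eta_fr; congr (_ * quartic_half _).
have -> : quartic (fr2 x) = fr2 (quartic x) by rewrite /quartic !rmorphXn !fmorph_div.
have -> : fr2 (quartic x) = quartic x ^+ (q ^ 2) by exact: (fr_iterE 2).
rewrite (_ : (q ^ 2 = 4 * (q ^ 2 %/ 4) + 1)%N).
  by rewrite exprD exprM quartic_exp4 // expr1n mul1r.
have : (q ^ 2 %% 4 = 1)%N by rewrite -modnXm q4.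
by move: (q ^ 2)%N => n; lia.
Qed.

End Signs.
End Field.

(** * Lines of the Hermitian surface as singular points *)

Section Geometry.

Local Open Scope ring_scope.

Variables (q : nat) (K : finFieldType) (fr : {rmorphism K -> K}).
Hypotheses (q4 : (q %% 4 = 3)%N) (cardK : #|K| = (q ^ 6)%N).
Hypothesis frE : forall x, fr x = x ^+ q.

Local Notation fr2 x := (fr (fr x)).
Local Notation bar x := (fr (fr (fr x))).
Local Notation fr4 x := (fr (fr (fr (fr x)))).

Let fr6 := fr6 cardK frE.

Definition tr6 x := x + fr2 x + fr4 x.
(** As for [cr], the first of three coordinates, conjugate under [fr2], of the cross product for the
    form tr6 (x y). *)
Definition xp x y := fr2 x * fr4 y - fr4 x * fr2 y.

Lemma tr6_fr2 x : fr2 (tr6 x) = tr6 x.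
Proof. by rewrite /tr6 !rmorphD fr6; ring. Qed.

Lemma tr6_bar x : bar (tr6 x) = tr6 (bar x).
Proof. by rewrite /tr6 !rmorphD. Qed.

Lemma tr6D x y : tr6 (x + y) = tr6 x + tr6 y.
Proof. by rewrite /tr6 !rmorphD; ring. Qed.

Lemma tr6Z a x : fr2 a = a -> tr6 (a * x) = a * tr6 x.
Proof. by move=> ha; rewrite /tr6 !rmorphM !ha; ring. Qed.

Lemma bar_xp x y : bar (xp x y) = xp (bar x) (bar y).
Proof. by rewrite /xp !rmorphB !rmorphM. Qed.

Lemma xp_xp x y z : xp (xp x y) z = y * tr6 (x * z) - x * tr6 (y * z).
Proof. by rewrite /xp /tr6 !(rmorphB, rmorphM) !fr6; ring. Qed.

Lemma xpC x y : xp y x = - xp x y. Proof. by rewrite /xp; ring. Qed.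

Lemma xpZl a x y : fr2 a = a -> xp (a * x) y = a * xp x y.
Proof. by move=> ha; rewrite /xp !rmorphM !ha; ring. Qed.
Lemma xpZr a x y : fr2 a = a -> xp x (a * y) = a * xp x y.
Proof. by move=> ha; rewrite /xp !rmorphM !ha; ring. Qed.
Lemma xpDl x y z : xp (x + y) z = xp x z + xp y z.
Proof. by rewrite /xp !rmorphD; ring. Qed.
Lemma xpDr x y z : xp x (y + z) = xp x y + xp x z.
Proof. by rewrite /xp !rmorphD; ring. Qed.
Lemma xpNl x y : xp (- x) y = - xp x y.
Proof. by rewrite /xp !rmorphN; ring. Qed.
Lemma xpNr x y : xp x (- y) = - xp x y.
Proof. by rewrite /xp !rmorphN; ring. Qed.
Lemma xpp x : xp x x = 0. Proof. by rewrite /xp mulrC subrr. Qed.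

Lemma tr6_xpl x y : tr6 (x * xp x y) = 0.
Proof. by rewrite /xp /tr6 !(rmorphB, rmorphM) !fr6; ring. Qed.
Lemma tr6_xpr x y : tr6 (y * xp x y) = 0.
Proof. by rewrite /xp /tr6 !(rmorphB, rmorphM) !fr6; ring. Qed.
Lemma tr6_xpC x y z : tr6 (x * xp y z) = - tr6 (y * xp x z).
Proof. by rewrite /xp /tr6 !(rmorphB, rmorphM) !fr6; ring. Qed.

Lemma xp0 x y : x != 0 -> xp x y = 0 -> fr2 (y / x) = y / x.
Proof.
move=> x0 /subr0_eq h; apply: (fmorph_inj fr); apply: (fmorph_inj fr).
rewrite !fmorph_div; apply/eqP; rewrite eqr_div ?fmorph_eq0 //.
by rewrite mulrC h mulrC.
Qed.

Lemma polarE x y : polar fr x y = tr6 (x * bar y) + bar (tr6 (x * bar y)).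
Proof. by rewrite /polar /t3 /tr6 !(rmorphD, rmorphM) !fr6; ring. Qed.

Lemma quadricE x : quadric fr x = (x != 0) && (tr6 (x * bar x) == 0).
Proof.
rewrite /quadric; congr (_ && (_ == _)).
by rewrite /t3 /tr6 !(rmorphD, rmorphM) !fr6; ring.
Qed.

Lemma fr2_bar a : fr2 a = a -> bar a = fr a. Proof. by move=> ->. Qed.

(* The totally isotropic line of the Hermitian space F_(q^6) + F_(q^2)
   attached to the singular point x of the elliptic quadric. *)
Definition hline x : {set K * K} :=
  [set p | (fr2 p.2 == p.2) && (xp x p.1 == p.2 * bar x)].

Lemma hlineP x p : reflect (fr2 p.2 = p.2 /\ xp x p.1 = p.2 * bar x) (p \in hline x).
Proof. by rewrite inE; apply: (iffP andP) => -[h1 h2]; split; apply/eqP. Qed.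

Definition hform (p r : K * K) := tr6 (p.1 * bar r.1) + p.2 * fr r.2.

Lemma hline_orth x p : quadric fr x -> p \in hline x -> tr6 (p.1 * bar x) = 0.
Proof.
rewrite quadricE => /andP[x0 /eqP qx] /hlineP[ha hp].
have [a0|a0] := eqVneq p.2 0.
  rewrite a0 mul0r in hp; have hc := xp0 x0 hp.
  by rewrite -[p.1](divfK x0) -(mulrA (p.1 / x)) tr6Z // qx mulr0.
apply: (mulfI a0); rewrite mulr0 -tr6Z // mulrCA -hp; exact: tr6_xpr.
Qed.

(** The product of [xp x p.1] with bar r.1 is - x * tr6 (p.1 * bar r.1) as a triple product, and p.2
    * fr r.2 * x by the equations of the line. Cancelling x leaves the form. *)
Lemma hline_isotropic x p r : quadric fr x -> p \in hline x -> r \in hline x -> hform p r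
  = 0.
Proof.
move=> qx hp hr; have := qx; rewrite quadricE => /andP[x0 /eqP qx'].
have /hlineP[ha ep] := hp; have /hlineP[hb er] := hr.
have h1 : tr6 (x * bar r.1) = 0.
  have : bar (tr6 (r.1 * bar x)) = 0 by rewrite (hline_orth qx hr) !rmorph0.
  by rewrite tr6_bar 3!rmorphM fr6 mulrC.
have := xp_xp x p.1 (bar r.1); rewrite h1 mulr0 sub0r ep xpZl // -bar_xp er 3!rmorphM fr6.
rewrite (fr2_bar hb) mulrA => /eqP; rewrite -addr_eq0 mulrC -mulrDr mulf_eq0 (negbTE x0) /=.
by rewrite /hform addrC => /eqP.
Qed.

(** Times p.2, the polar form is the sum of x * xp x' p.1 and x' * xp x p.1 under [tr6], which
    vanishes by antisymmetry. If p.2 = 0, both x and x' are F_(q^2)-multiples of p.1. *)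
Lemma hline_meet x x' p : quadric fr x -> quadric fr x' -> p != 0 ->
  p \in hline x -> p \in hline x' -> polar fr x x' = 0.
Proof.
rewrite !quadricE => /andP[x0 /eqP qx] /andP[x0' /eqP qx'] p0 /hlineP[ha e1] /hlineP[_ e2].
rewrite polarE; have [a0|a0] := eqVneq p.2 0.
  have y0 : p.1 != 0.
    by apply: contraNneq p0 => y0; apply/eqP; rewrite [LHS]surjective_pairing a0 y0.
  rewrite a0 mul0r in e1; rewrite a0 mul0r in e2.
  have h1 := xp0 x0 e1; have h2 := xp0 x0' e2.
  set c := p.1 / x in h1; set c' := p.1 / x' in h2.
  have c0' : c' != 0 by rewrite mulf_neq0 ?invr_eq0.
  have ex : x' = (c / c') * x by rewrite /c /c'; field; rewrite x0 y0 x0'.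
  clearbody c c'.
  have hd : fr2 (c / c') = c / c' by rewrite !fmorph_div h1 h2.
  have hd' : fr2 (bar (c / c')) = bar (c / c') by rewrite -{2}hd.
  by rewrite ex 3!rmorphM mulrCA tr6Z // qx mulr0 !rmorph0 addr0.
have e3 : p.2 * tr6 (x * bar x') = tr6 (x * xp x' p.1) by rewrite -tr6Z // mulrCA -e2.
have e4 : p.2 * bar (tr6 (x * bar x')) = tr6 (x' * xp x p.1).
  by rewrite tr6_bar -tr6Z // 3!rmorphM fr6 e1; congr tr6; ring.
by apply: (mulfI a0); rewrite mulr0 mulrDr e3 e4 tr6_xpC addNr.
Qed.

Lemma hline_join x x' : quadric fr x -> quadric fr x' -> polar fr x x' = 0 ->
  let p := (xp (bar x) (bar x'), tr6 (x * bar x')) in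
  (p \in hline x) && (p \in hline x').
Proof.
rewrite !quadricE polarE => /andP[x0 /eqP qx] /andP[x0' /eqP qx'] h /=.
have h2 := tr6_fr2 (x * bar x').
have e a b c : xp a (xp b c) = b * tr6 (a * c) - c * tr6 (a * b).
  by rewrite xpC xp_xp opprB [b * a]mulrC [c * a]mulrC.
apply/andP; split; apply/hlineP; split=> //=; rewrite e.
  by rewrite qx mulr0 subr0 mulrC.
rewrite qx' mulr0 sub0r.
have -> : tr6 (x' * bar x) = bar (tr6 (x * bar x')).
  by rewrite tr6_bar 3!rmorphM fr6 mulrC.
by move: h => /eqP; rewrite addrC addr_eq0 => /eqP ->; rewrite mulrN opprK mulrC.
Qed.

Lemma card_tr60 : #|[set y : K | tr6 y == 0]| = (q ^ 4)%N.
Proof.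
have [] := @fiber_card K K [set: K] [set y | tr6 y == 0]
   (fun x => fr2 x - x) (q ^ 4) (q ^ 2).
- by move=> x _; rewrite inE /tr6 !rmorphB fr6; apply/eqP; ring.
- move=> y _; have := card_root_fr q4 cardK frE 2 (fun i =>
  if i == 0%N then -1 else 0) (- y).
  apply: leq_trans; apply: subset_leq_card; apply/subsetP => x; rewrite !inE /=.
  by rewrite !big_ord_recr big_ord0 /= => /eqP <-; apply/eqP; ring.
- have := card_root_fr q4 cardK frE 4 (fun i => if odd i then 0 else 1) 0.
  apply: leq_trans; apply: subset_leq_card; apply/subsetP => x; rewrite !inE /=.
  by rewrite !big_ord_recr big_ord0 /= => /eqP h; apply/eqP; rewrite -[RHS]h /tr6; ring.
- by rewrite cardsT cardK -expnD.
- by rewrite expn_gt0; have := q_gt2 q4; lia.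
by [].
Qed.

Lemma card_perp6 x : x != 0 -> #|[set u | tr6 (x * u) == 0]| = (q ^ 4)%N.
Proof.
move=> x0; rewrite -card_tr60 -(card_imset _ (mulfI x0)); apply: eq_card => v.
rewrite inE; apply/imsetP/idP => [[u]|hv]; first by rewrite inE => hu ->.
by exists (v / x); rewrite ?inE mulrC divfK.
Qed.

(** [xp x] is F_(q^2)-linear with kernel F_(q^2) x and image in the orthogonal of x; the sizes leave
    no slack. *)
Lemma card_xp x u : x != 0 -> tr6 (x * u) = 0 -> #|[set y | xp x y == u]| = (q ^ 2)%N.
Proof.
move=> x0 hu; have [] := @fiber_card K K [set: K] [set u | tr6 (x * u) == 0]
   (xp x) (q ^ 4) (q ^ 2).
- by move=> y _; rewrite inE tr6_xpl.
- move=> v _; have [->|/set0Pn[z0]] := eqVneq [set y in [set: K] | xp x y == v] set0.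
    by rewrite cards0.
  rewrite !inE /= => /eqP hz0.
  have gI : injective (fun c => z0 + c * x) by move=> c c' /addrI/(mulIf x0).
  rewrite -(card_fr2 q4 cardK frE) -[X in (_ <= X)%N](card_imset _ gI).
  apply: subset_leq_card; apply/subsetP => z; rewrite !inE /= => /eqP hz.
  apply/imsetP; exists ((z - z0) / x); last by rewrite divfK // addrC subrK.
  by rewrite inE; apply/eqP/xp0 => //; rewrite xpDr xpNr hz hz0 subrr.
- by rewrite card_perp6.
- by rewrite cardsT cardK -expnD.
- by rewrite expn_gt0; have := q_gt2 q4; lia.
move=> _ /(_ u); rewrite inE hu eqxx => <- //.
by apply: eq_card => y; rewrite !inE.
Qed.

Lemma card_hline x : quadric fr x -> #|hline x| = (q ^ 4)%N.
Proof.
rewrite quadricE => /andP[x0 /eqP qx].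
rewrite (@card_fibers _ _ _ (fun a => fr2 a == a) (fun p : K * K => p.2)); last first.
  by move=> p; rewrite inE => /andP[].
rewrite (eq_bigr (fun _ => (q ^ 2)%N)) => [|a /eqP ha].
  by rewrite sum_nat_const -cardsE (card_fr2 q4 cardK frE) -expnD.
rewrite -(@card_xp x (a * bar x)) //; last by rewrite mulrCA tr6Z // qx mulr0.
have gI : injective (fun y : K => (y, a)) by move=> y y' [].
rewrite -[RHS](card_imset _ gI); apply: eq_card => -[y b].
rewrite !inE /=; apply/andP/imsetP => [[/andP[_ /eqP e] /eqP eb]|[y' hy' [-> ->]]].
  by exists y; rewrite ?inE ?e ?eb.
by rewrite ha eqxx; rewrite inE in hy'; rewrite hy'.
Qed.

Lemma hline0 x : 0 \in hline x.
Proof. by apply/hlineP; rewrite /= !rmorph0 mul0r /xp !rmorph0 !mulr0 subrr. Qed.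

Lemma quadric_neq0 x : quadric fr x -> x != 0. Proof. by case/andP. Qed.

Lemma hline_Z r x : r != 0 -> fr r = r -> hline (r * x) = hline x.
Proof.
move=> r0 hr; apply/setP => p; rewrite !inE xpZl ?hr // 3!rmorphM !hr.
by rewrite mulrCA (inj_eq (mulfI r0)).
Qed.

Lemma polar_Z r x : fr r = r -> quadric fr x -> polar fr x (r * x) = 0.
Proof.
move=> hr; rewrite quadricE polarE => /andP[_ /eqP qx].
by rewrite 3!rmorphM !hr mulrCA tr6Z ?hr // qx mulr0 !rmorph0 addr0.
Qed.

(** Proportional points are orthogonal too, so for equal lines both terms contribute: q^4 - 1 = (q^2
    - 1) + (q^4 - q^2). In this form the count pairs directly with [hsign_eigen] and
    [sum_hsign_prop]. *)
Lemma card_meet x x' : quadric fr x -> quadric fr x' ->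
  (#|[set p in hline x :&: hline x' | p != 0]|%:Z
   = ((q ^ 2)%:Z - 1) * (polar fr x x' == 0)%:Z
     + ((q ^ 4)%:Z - (q ^ 2)%:Z) * (fr (x' / x) == x' / x)%:Z)%R.
Proof.
move=> qx qx'; have x0 := quadric_neq0 qx; have x0' := quadric_neq0 qx'.
have [hr|nr] := eqVneq (fr (x' / x)) (x' / x).
  have r0 : x' / x != 0 by rewrite mulf_neq0 ?invr_eq0.
  have ex : x' = (x' / x) * x by rewrite divfK.
  have -> : hline x' = hline x by rewrite ex hline_Z.
  have -> : polar fr x x' = 0 by rewrite ex polar_Z.
  have h : (1 + #|hline x :\ (0 : K * K)%R| = q ^ 4)%N.
    by rewrite -(card_hline qx) (cardsD1 (0 : K * K) (hline x)) hline0.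
  rewrite setIid.
  have -> : [set p in hline x | p != 0] = hline x :\ (0 : K * K).
    by apply/setP => p; rewrite !inE andbC.
  by rewrite ?eqxx /= !mulr1; move: h; set n := #|_|; lia.
have [hp|np] := eqVneq (polar fr x x') 0; last first.
  rewrite !mulr0 addr0 (_ : [set p in _ | _] = set0) ?cards0 //.
  apply/setP => p; rewrite in_set0 inE; apply/negP => /andP[/setIP[h1 h2] p0].
  by move: np; rewrite (hline_meet qx qx' p0 h1 h2) eqxx.
suff [p0 [p0n h]] : exists p0 : K * K, p0 != 0 /\ hline x :&: hline x'
     = [set (c * p0.1, c * p0.2) | c in [set c | fr2 c == c]].
  have : (#|hline x :&: hline x'| = q ^ 2)%N.
    rewrite h card_imset ?(card_fr2 q4 cardK frE) //.
    move=> c d [] e1 e2; case: (eqVneq p0.1 0) => y0; last by apply: (mulIf y0).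
    case: (eqVneq p0.2 0) => a0; last by apply: (mulIf a0).
    by case/eqP: p0n; rewrite [LHS]surjective_pairing y0 a0.
  move=> h2; have h1 : (1 + #|(hline x :&: hline x') :\ (0 : K * K)%R| = q ^ 2)%N.
    by rewrite -h2 (cardsD1 (0 : K * K) (hline x :&: hline x')) inE !hline0.
  have -> : [set p in hline x :&: hline x' | p != 0] = (hline x :&: hline x') :\ (0 : K *
    K).
    by apply/setP => p; rewrite !inE andbC.
  rewrite ?eqxx /= mulr1 mulr0 addr0; move: h1; set n := #|_|; lia.
(* If x' is an F_(q^2)-multiple of x, the vector of [hline_join] is 0 and the common point is (x, 0)
   instead. *)
have [hd|nd] := eqVneq (fr2 (x' / x)) (x' / x).
  exists (x, 0); split; first by apply: contra_neq x0 => -[].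
  apply/setP => -[y a]; apply/setIP/imsetP => [[/hlineP[/= ha e1] /hlineP[/= _ e2]]|[c]].
    have a0 : a = 0.
      apply/eqP; apply: contraR nr => a0.
      have b0 : a * bar x != 0 by rewrite mulf_neq0 ?fmorph_eq0.
      have gen d : x' = d * x -> fr2 d = d -> d * (a * bar x) = fr d * (a * bar x).
        move=> ed hd'; move: e2; rewrite ed xpZl // e1 3!rmorphM => ->.
        by rewrite (fr2_bar hd'); ring.
      by apply/eqP; apply: (mulIf b0); rewrite -gen ?divfK.
    rewrite a0 mul0r in e1; exists (y / x); last by rewrite a0 mulr0 /= divfK.
    by rewrite inE; apply/eqP/xp0.
  rewrite inE => /eqP hc [-> ->]; rewrite mulr0.
  have e z : z != 0 -> fr2 (x / z) = x / z -> (c * x, 0) \in hline z.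
    move=> z0 hz; apply/hlineP; rewrite /= !rmorph0 mul0r -[x](divfK z0) !xpZr // xpp
      !mulr0 //.
  split; apply: e => //; first by rewrite divff // !rmorph1.
  by rewrite -invf_div !fmorphV hd.
exists (xp (bar x) (bar x'), tr6 (x * bar x')).
have w0 : xp (bar x) (bar x') != 0.
  rewrite -bar_xp !fmorph_eq0; apply: contraNneq nd => h0; exact/eqP/xp0.
have /andP[j1 j2] := hline_join qx qx' hp.
move: j1 j2; set w := xp _ _ in w0 *; set h := tr6 _ => j1 j2.
have key y : xp x y = 0 -> xp x' y = 0 -> y = 0.
  move=> e1 e2; apply/eqP; apply: contraR nd => y0.
  have h1 := xp0 x0 e1; have h2 := xp0 x0' e2.
  have -> : x' / x = (y / x) / (y / x') by field; rewrite x0 y0 x0'.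
  by rewrite (fmorph_div _ (y / x)) (fmorph_div _ (fr (y / x))) h1 h2.
have /hlineP[/= hh w1] := j1; have /hlineP[/= _ w2] := j2.
have h0 : h != 0.
  apply: contra_neq w0 => h0; apply: key; first by rewrite w1 h0 mul0r.
  by rewrite w2 h0 mul0r.
split; first by apply: contra_neq w0 => -[].
apply/setP => -[y a]; apply/setIP/imsetP => [[/hlineP[/= ha e1] /hlineP[/= _ e2]]|[c]].
  have hc : fr2 (a / h) = a / h by rewrite !fmorph_div ha hh.
  exists (a / h); first by rewrite inE hc.
  rewrite /= divfK //; congr pair; apply/eqP; rewrite -subr_eq0; apply/eqP; apply: key.
    by rewrite xpDr xpNr xpZr // e1 w1 mulrA divfK // subrr.
  by rewrite xpDr xpNr xpZr // e2 w2 mulrA divfK // subrr.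
rewrite inE => /eqP hc [-> ->]; split; apply/hlineP; rewrite /= !rmorphM hc hh xpZr //.
  by rewrite w1 mulrA.
by rewrite w2 mulrA.
Qed.

Lemma antiF_ex : exists c : K, [/\ c != 0, fr2 c = c & fr c = - c].
Proof.
have q2 := q_gt2 q4.
have h : (#|[set x : K | fr x == x]| < #|[set x : K | fr2 x == x]|)%N.
  by rewrite (card_fr q4 cardK frE) (card_fr2 q4 cardK frE) -{1}[q]expn1 ltn_exp2l //; lia.
have [d] : exists d, d \in [set x | fr2 x == x] :\: [set x | fr x == x].
  apply/set0Pn; rewrite -card_gt0 cardsD subn_gt0; apply: leq_ltn_trans h.
  by apply: subset_leq_card; apply: subsetIr.
rewrite !inE => /andP[h1 /eqP h2]; exists (fr d - d); rewrite subr_eq0 !rmorphB h2 h1.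
by split=> //; rewrite opprB.
Qed.

(* The elements counted are the fixed points of a semilinear involution,
   x |-> bar (xp x y), of the orthogonal of y. *)
Lemma card_unit_point y : y != 0 -> tr6 (y * bar y) = -1 ->
  #|[set x | xp x y == bar x]| = (q ^ 2)%N.
Proof.
move=> y0 hy; have [c [c0 hc hc1]] := antiF_ex.
have t0 := two_neq0 q4 cardK.
pose J x := bar (xp x y).
have JJ x : tr6 (x * bar y) = 0 -> J (J x) = x.
  move=> hx; rewrite /J bar_xp fr6 xp_xp hx hy; ring.
have JY x : tr6 (J x * bar y) = 0.
  by rewrite -rmorphM -rmorphM -rmorphM -tr6_bar mulrC tr6_xpr !rmorph0.
have fixJ x : (xp x y == bar x) = (J x == x).
  by apply/eqP/eqP => e; [rewrite /J e fr6 | rewrite -{2}e /J fr6].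
have JD u v : J (u + v) = J u + J v by rewrite /J xpDl !rmorphD.
have JN u : J (- u) = - J u by rewrite /J xpNl !rmorphN.
have JZ u : J (c * u) = - (c * J u) by rewrite /J xpZl // 3!rmorphM (fr2_bar hc) hc1 mulNr.
have J2 u : J (u / 2) = J u / 2.
  have h2 : fr 2^-1 = 2^-1 :> K by rewrite fmorphV rmorph_nat.
  by rewrite [u / 2]mulrC /J xpZl ?h2 // 3!rmorphM !h2 mulrC.
have yb w : tr6 (y * bar w) = bar (tr6 (w * bar y)).
  by rewrite tr6_bar 3!rmorphM fr6 mulrC.
(* J anticommutes with multiplication by c, so every element of the orthogonal is uniquely u + c v
   with u and v fixed by J. The outer [bar] matches the form of the orthogonal in [card_perp6]. *)
clearbody J; set A := [set x | _]; have cA : (#|A| * #|A| = q ^ 2 * q ^ 2)%N.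
  rewrite -cardsX -expnD -(card_perp6 y0).
  have gI : {in setX A A &, injective (fun p : K * K => bar (p.1 + c * p.2))}.
    move=> [u v] [u' v']; rewrite !inE /= !fixJ =>
      /andP[/eqP hu /eqP hv] /andP[/eqP hu' /eqP hv'].
    move=> /fmorph_inj/fmorph_inj/fmorph_inj e.
    have e' : u - c * v = u' - c * v'.
      by move/(congr1 J): e; rewrite !JD !JZ hu hv hu' hv'.
    have ev : v = v'.
      apply: (mulfI (mulf_neq0 t0 c0)).
      transitivity ((u + c * v) - (u - c * v)); first by ring.
      by rewrite e e'; ring.
    by move: e; rewrite ev => /addIr ->.
  rewrite -(card_in_imset gI); apply: eq_card => z.
  rewrite !inE; apply/imsetP/eqP => [[[u v]]|hz].
    rewrite inE /= !inE !fixJ => /andP[/eqP hu /eqP hv] ->.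
    by rewrite yb mulrDl -mulrA tr6D (tr6Z _ hc) -hu -hv !JY mulr0 addr0 !rmorph0.
  set x := bar z; have hx : tr6 (x * bar y) = 0.
    have : bar (tr6 (y * z)) = 0 by rewrite hz !rmorph0.
    by rewrite tr6_bar 3!rmorphM mulrC.
  have zx : z = bar x by rewrite /x fr6.
  clearbody x; exists ((x + J x) / 2, (x - J x) / 2 / c).
    rewrite !inE /= !fixJ J2 JD (JJ _ hx) addrC eqxx /=.
    have e : J (c * ((x - J x) / 2 / c)) = J ((x - J x) / 2) by congr J; field;
      rewrite t0 c0.
    move: e; rewrite JZ J2 JD JN (JJ _ hx) => e; apply/eqP.
    apply: (mulfI c0); apply: oppr_inj; rewrite e; field; rewrite t0 c0 //.
  by rewrite /= zx; congr (fr (fr (fr _))); field; rewrite t0 c0.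
by apply/eqP; rewrite -eqn_sqr -!mulnn cA.
Qed.

(** If a = 0, these x are the nonzero F_(q^2)-multiples of y. Otherwise dividing y by a reduces to
    [card_unit_point], where singularity is automatic: bar x = xp x z is orthogonal to x. *)
Lemma card_hlines_point p : p != 0 -> fr2 p.2 = p.2 -> hform p p = 0 ->
  #|[set x | quadric fr x && (p \in hline x)]| = (q ^ 2 - 1)%N.
Proof.
case: p => y a p0 /= ha hp; rewrite /hform /= in hp.
have [a0|a0] := eqVneq a 0.
  have y0 : y != 0 by apply: contraNneq p0 => ->; rewrite a0.
  rewrite a0 mul0r addr0 in hp.
  rewrite -(card_fr2 q4 cardK frE) (cardsD1 0 [set x : K | fr2 x == x]) inE !rmorph0 eqxx
    addKn.
  rewrite -[RHS](card_imset _ (mulIf y0)); apply: eq_card => x.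
  rewrite inE; apply/andP/imsetP => [[qx /hlineP[/= _]]|[c]].
    have x0 := quadric_neq0 qx; rewrite a0 mul0r => e; exists (x / y);
      last by rewrite divfK.
    rewrite !inE mulf_neq0 ?invr_eq0 //=; apply/eqP/xp0 => //.
    by rewrite xpC e oppr0.
  rewrite !inE => /andP[c0 /eqP hc] ->; split; last first.
    by rewrite a0 !rmorph0 xpZl // xpp mulr0 mul0r !eqxx.
  rewrite quadricE mulf_neq0 //= 3!rmorphM mulrACA tr6Z ?hp ?mulr0 //.
  by rewrite (fr2_bar hc) !rmorphM !hc.
pose z := y / a.
have hz : tr6 (z * bar z) = -1.
  have ha' : fr2 (a * bar a) = a * bar a by rewrite (fr2_bar ha) !rmorphM !ha.
  have n0 : a * bar a != 0 by rewrite mulf_neq0 ?fmorph_eq0.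
  apply: (mulfI n0); rewrite -tr6Z // mulrN1 (fr2_bar ha).
  have -> : a * fr a * (z * bar z) = y * bar y.
    by rewrite /z !fmorph_div (fr2_bar ha); field; rewrite ?fmorph_eq0 a0.
  by apply/eqP; rewrite -addr_eq0 hp.
have z0 : z != 0.
  apply/eqP => z0; move: hz; rewrite z0 mul0r /tr6 !rmorph0 !addr0 => /esym/eqP.
  by rewrite oppr_eq0 oner_eq0.
rewrite -(card_unit_point z0 hz) [in RHS](cardsD1 0) inE !rmorph0 {1}/xp !rmorph0 !mul0r
  subrr eqxx addKn.
apply: eq_card => x; rewrite !inE quadricE /= ha eqxx /=.
have -> : (xp x y == a * bar x) = (xp x z == bar x).
  have -> : y = a * z by rewrite /z mulrC divfK.
  by rewrite xpZr // (inj_eq (mulfI a0)).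
case: (eqVneq (xp x z) (bar x)) => [e|]; rewrite ?andbF // !andbT.
by rewrite -e tr6_xpl eqxx andbT.
Qed.

Section Signs.

Variable vs : K.
Hypothesis hvs : cone fr vs.
Local Notation hsign := (hsign q fr vs).

Lemma sum_hsign_prop x : quadric fr x ->
  \sum_(x' | quadric fr x' && (fr (x' / x) == x' / x)) hsign x' = (q%:Z - 1) * hsign x.
Proof.
move=> qx; have x0 := quadric_neq0 qx; have q2 := q_gt2 q4.
rewrite (reindex_inj (mulIf x0)) /=.
have aux r : r != 0 -> fr r = r -> fr (r * bar r) = r * bar r /\ quartic q fr r = 1.
  by move=> r0 hr; rewrite !rmorphM !hr; split=> //; apply: quartic1 => //; rewrite !hr.
rewrite (eq_bigr (fun _ => hsign x)); last first.
  move=> r /andP[/quadric_neq0 rx0 /eqP]; rewrite mulfK // => hr.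
  have r0 : r != 0 by apply: contraNneq rx0 => ->; rewrite mul0r.
  by have [h1 h2] := aux r r0 hr; apply: (hsign_Z q4 cardK frE hvs).
rewrite sumr_const -[LHS]mulr_natl natz; congr (_ * _).
rewrite (_ : #|_| = #|[set r : K | fr r == r] :\ 0|); last first.
  apply: eq_card => r; rewrite !inE [LHS]unfold_in mulfK // andbC [RHS]andbC.
  case: eqVneq => //= hr; apply/idP/idP => [/quadric_neq0|r0].
    by apply: contraNneq => ->; rewrite mul0r.
  by have [h1 h2] := aux r r0 hr; apply: (quadric_Z).
have : (1 + #|[set r : K | fr r == r] :\ 0%R| = q)%N.
  by rewrite -[RHS](card_fr q4 cardK frE) [RHS](cardsD1 0) inE rmorph0 eqxx.
by set n := #|_|; lia.
Qed.

Lemma sum_hsign_point p : p != 0 ->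
  \sum_(x | quadric fr x && (p \in hline x)) hsign x = 0.
Proof.
move=> p0; pose g p := \sum_(x | quadric fr x && (p \in hline x)) hsign x.
suff : \sum_(p : K * K | p != 0) g p ^+ 2 = 0.
  move=> h; have : g p ^+ 2 == 0.
    by have := @psumr_eq0P _ _ (fun p : K * K => p != 0) (fun p =>
      g p ^+ 2) (fun p _ => sqr_ge0 (g p)) h p p0 => ->.
  by rewrite sqrf_eq0 => /eqP.
have gE p' : g p' = \sum_(x | quadric fr x) (p' \in hline x)%:Z * hsign x.
  rewrite /g big_mkcondr; apply: eq_bigr => x _; case: (_ \in _); by rewrite ?mul1r ?mul0r.
transitivity (\sum_(x | quadric fr x) hsign x * \sum_(x' | quadric fr x')
   hsign x' * #|[set p in hline x :&: hline x' | p != 0]|%:Z).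
  transitivity (\sum_(p : K * K | p != 0) \sum_(x | quadric fr x) \sum_(x' | quadric fr x')
      hsign x * (hsign x' * ((p \in hline x) && (p \in hline x'))%:Z)).
    apply: eq_bigr => p' _; rewrite expr2 gE mulr_suml; apply: eq_bigr => x _.
    rewrite mulr_sumr; apply: eq_bigr => x' _.
    by case: (_ \in hline x); case: (_ \in hline x');
      rewrite /= ?mul0r ?mulr0 ?mul1r ?mulr1 ?mulr0.
  rewrite exchange_big; apply: eq_bigr => x _; rewrite exchange_big mulr_sumr.
  apply: eq_bigr => x' _; rewrite -mulr_sumr; congr (_ * _); rewrite -mulr_sumr;
    congr (_ * _).
  rewrite -sum1_card -[RHS]natz natr_sum big_mkcond [RHS]big_mkcond; apply: eq_bigr => p' _.
  by rewrite !inE; case: (p' != 0); rewrite ?andbF ?andbT //; case: (_ && _).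
rewrite big1 // => x qx.
rewrite (_ : \sum_(x' | _) _ = 0) ?mulr0 //.
transitivity (\sum_(x' | quadric fr x') (((q ^ 2)%:Z - 1) * ((polar fr x x' == 0)%:Z *
  hsign x')
   + ((q ^ 4)%:Z - (q ^ 2)%:Z) * ((fr (x' / x) == x' / x)%:Z * hsign x'))).
  by apply: eq_bigr => x' qx'; rewrite card_meet //; ring.
have ind (P : pred K) : \sum_(x' | quadric fr x') ((P x')%:Z * hsign x')
   = \sum_(x' | quadric fr x' && P x') hsign x'.
  by rewrite [RHS]big_mkcondr; apply: eq_bigr => x' _; case: (P x'); rewrite ?mul1r ?mul0r.
rewrite big_split -!mulr_sumr /= (ind (fun x' => polar fr x x' == 0)) (ind (fun x' =>
  fr (x' / x) == x' / x)).
rewrite (hsign_eigen q4 cardK frE hvs qx) sum_hsign_prop //.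
(* The two contributions, (q^2 - 1) times the eigenvalue - q^2 (q - 1) and (q^4 - q^2)(q - 1),
   cancel. *)
have -> : (q ^ 4)%:Z = (q ^ 2)%:Z * (q ^ 2)%:Z by rewrite -PoszM -expnD.
rewrite !expnS expn0 muln1 !PoszM; ring.
Qed.

Lemma card_hsign_point p : p != 0 -> fr2 p.2 = p.2 -> hform p p = 0 ->
  (#|[set x | [&& quadric fr x, p \in hline x & hsign x == 1%R]]| * 2 = q ^ 2 - 1)%N.
Proof.
move=> p0 hp2 hp; have := card_hlines_point p0 hp2 hp; have := sum_hsign_point p0.
set A := [set x | [&& quadric fr x, p \in hline x & hsign x == 1]];
  pose B := [set x | [&& quadric fr x, p \in hline x & hsign x != 1]].
rewrite (bigID (fun x => hsign x == 1)) /= => h1 h2.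
have eA : \sum_(x | quadric fr x && (p \in hline x) && (hsign x == 1)) hsign x = #|A|%:Z.
  rewrite (eq_bigr (fun _ => 1)) => [|x /andP[_ /eqP]//].
  rewrite sumr_const natz; congr _%:Z; apply: eq_card => x;
    by rewrite [LHS]unfold_in [RHS]inE -andbA.
have eB : \sum_(x | quadric fr x && (p \in hline x) && (hsign x != 1)) hsign x = - #|B|%:Z.
  rewrite (eq_bigr (fun _ => -1)) => [|x /andP[/andP[qx _] h]].
    rewrite sumrN sumr_const natz; congr (- _%:Z); apply: eq_card => x;
      by rewrite [LHS]unfold_in [RHS]inE -andbA.
  by case: (hsign_signP q4 cardK frE hvs qx) h => -> //; rewrite eqxx.
have eAB : (#|A| + #|B| = q ^ 2 - 1)%N.
  rewrite -h2 -(cardsID [set x | hsign x == 1] [set x | quadric fr x && (p \in hline x)]).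
  by congr (_ + _)%N; apply: eq_card => x; rewrite !inE; case: (hsign x == 1);
    rewrite ?andbF ?andbT.
move: h1 eAB; rewrite eA eB; move: #|A| #|B| => a b; lia.
Qed.

End Signs.

End Geometry.

(** * Orthonormal bases of Hermitian forms *)

(** In a splitting field L of X^N - X over F, the roots are distinct, as the derivative is -1, and
    form the fixed field of the n-th power of the Frobenius over F. That field contains F and the
    generators of L, so it is L. *)
Lemma finField_extension (F : finFieldType) (n : nat) : (0 < n)%N ->
  exists (K : finFieldType) (io : {rmorphism F -> K}), #|K| = (#|F| ^ n)%N.
Proof.
move=> n0; set N := (#|F| ^ n)%N; have F1 := finNzRing_gt1 F.
have N1 : (1 < N)%N by rewrite -[X in (X < _)%N](expn0 #|F|) ltn_exp2l.
pose P (R : nzRingType) : {poly R} := ('X^N - 'X)%R.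
have szP R : size (P R) = N.+1.
  by rewrite /P size_polyDl ?size_polyXn // size_polyN size_polyX.
have P0 : (P F != 0)%R by rewrite -size_poly_gt0 szP.
have [L splitL] := FinSplittingFieldFor P0.
have PL : map_poly (in_alg L) (P F) = P L by rewrite /P rmorphB rmorphXn /= map_polyX.
rewrite PL in splitL; have [zs DzsL defL] := splitL.
have Np : (N%:R = 0 :> L)%R.
  have h : (#|F|%:R = 0 :> F)%R.
    have := @expg_cardG F [set: F]%G 1%R (in_setT _); rewrite cardsT => h; exact: h.
  have : (#|F|%:R = 0 :> L)%R by rewrite -(rmorph_nat (in_alg L)) h rmorph0.
  by rewrite /N natrX => ->; rewrite expr0n; case: (n) n0.
have Uzs : uniq zs.
  rewrite -separable_prod_XsubC -(eqp_separable DzsL) separable_poly.unlock.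
  rewrite /P derivB derivXn derivX -scaler_nat Np.
  by rewrite scale0r sub0r -[X in coprimep _ X]scaleN1r coprimepZr ?oppr_eq0 ?oner_eq0
    ?coprimep1.
have [a _ Da] := finField_galois_generator (sub1v {:L}%AS).
rewrite dimv1 expn1 in Da.
pose E := fixedSpace (a ^+ n)%g.
have zsE : zs =i E.
  move=> z; rewrite -root_prod_XsubC -(eqp_root DzsL) (sameP fixedSpaceP eqP).
  rewrite /root !hornerE subr_eq0 /N; congr (_ == z).
  elim: (n) => [|i IHi]; first by rewrite expr1 expg0 gal_id.
  by rewrite expgSr galM ?memvf // Da ?memvf // -IHi expnSr exprM.
have EL : E = {:L}%VS.
  apply/eqP; rewrite eqEsubv subvf -defL -[E]subfield_closed agenvS //.
  by rewrite subv_add sub1v; apply/span_subvP=> z; rewrite zsE.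
exists (FinFieldExtType L), (in_alg L).
have /eq_card-> : FinFieldExtType L =i zs by move=> z; rewrite zsE EL memvf.
apply: succn_inj; rewrite (card_uniqP _) //= -(size_prod_XsubC _ id).
by rewrite -(eqp_size DzsL) szP.
Qed.

Section Orthonormal.

Local Open Scope ring_scope.

Variables (q : nat) (F : finFieldType) (theta : {rmorphism F -> F}).
Hypotheses (q4 : (q %% 4 = 3)%N) (cardF : #|F| = (q ^ 2)%N).
Hypothesis thetaE : forall x, theta x = x ^+ q.

Lemma theta_inv x : theta (theta x) = x.
Proof. by rewrite !thetaE -exprM -[RHS]expf_card cardF. Qed.

(** At most q + 1 elements share a norm and [theta] fixes at most q - 1 nonzero ones; the product is
    q^2 - 1, so both bounds are attained. *)
Lemma norm_surj d : d != 0 -> theta d = d -> exists t, t * theta t = d.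
Proof.
move=> d0 hd; have q2 : (2 < q)%N by move: q4; lia.
have szX n (c : F) : size ('X^(n.+1) - c%:P : {poly F})%R = n.+2 by exact: size_XnsubC.
have Xle n (c : F) : (#|[set x : F | (x ^+ n.+1 - c == 0)%R]| <= n.+1)%N.
  apply: (@card_root_le _ _ ('X^(n.+1) - c%:P : {poly F})%R);
    rewrite ?szX // -?size_poly_gt0 ?szX //.
  by move=> x; rewrite !hornerE.
have [] := @fiber_card F F [set x | x != 0] [set y | (y != 0) && (theta y == y)]
   (fun t => t * theta t) (q - 1) (q + 1).
- move=> t; rewrite !inE => t0; rewrite mulf_neq0 ?fmorph_eq0 //= rmorphM theta_inv.
  by rewrite mulrC.
- move=> y _; apply: leq_trans (subset_leq_card _) (_ : #|[set x : F | (x ^+ q.+1 - y ==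
  0)%R]| <= q + 1)%N; last first.
    by rewrite addn1.
  apply/subsetP => x; rewrite !inE => /andP[_ /eqP <-].
  by rewrite thetaE exprS subrr.
- have -> : (q - 1 = (q - 2).+1)%N by lia.
  apply: leq_trans (Xle (q - 2)%N 1); apply: subset_leq_card.
  apply/subsetP => y; rewrite !inE thetaE => /andP[y0 /eqP hy].
  rewrite subr_eq0 -(inj_eq (mulfI y0)) -exprS mulr1.
  by rewrite (_ : ((q - 2).+2 = q)%N) ?hy //; lia.
- have := cardF; rewrite (cardD1 0) inE /= => h.
  rewrite (_ : #|_| = #|[predD1 F & 0]|); last by apply: eq_card => x; rewrite !inE andbT.
  move: h; rewrite -add1n; set n := #|_|; nia.
- by rewrite addn1.
move=> _ /(_ d); rewrite inE d0 hd eqxx => /(_ isT) h.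
have : (0 < #|[set x in [set x | x != 0%R] | (x * theta x == d)%R]|)%N by rewrite h addn1.
by case/card_gt0P => t; rewrite !inE => /andP[_ /eqP]; exists t.
Qed.

Variables (V : finZmodType) (sc : F -> V -> V) (B : V -> V -> F) (n : nat).
Hypothesis cardV : #|V| = (#|F| ^ n)%N.
Hypothesis BD : forall u v w, B (u + v) w = B u w + B v w.
Hypothesis BZ : forall a u w, B (sc a u) w = a * B u w.
Hypothesis BC : forall u w, B w u = theta (B u w).
Hypothesis Bnondeg : forall u, (forall w, B u w = 0) -> u = 0.

Lemma sform0l w : B 0 w = 0.
Proof. by apply: (addIr (B 0 w)); rewrite -BD !add0r. Qed.
Lemma sformNl u w : B (- u) w = - B u w.
Proof. by apply/eqP; rewrite -addr_eq0 -BD addNr sform0l. Qed.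
Lemma sformDr u v w : B w (u + v) = B w u + B w v.
Proof. by rewrite BC BD rmorphD -!BC. Qed.
Lemma sformZr a u w : B w (sc a u) = theta a * B w u.
Proof. by rewrite BC BZ rmorphM -BC. Qed.
Lemma sformNr u w : B w (- u) = - B w u.
Proof. by rewrite BC sformNl rmorphN -BC. Qed.
Lemma sform_suml (I : finType) (G : I -> V) w : B (\sum_i G i) w = \sum_i B (G i) w.
Proof. by apply: (big_morph (fun u => B u w)) => [u v|]; rewrite ?BD ?sform0l. Qed.

Definition orthonormal_family k (u : 'I_k -> V) :=
  forall i j, B (u i) (u j) = (i == j)%:R.

(** Gram-Schmidt, with cardinality for dimension: if all projections vanished, k vectors would span
    V. The scalar action is abstract because both F^4 and F_(q^6), where F acts through an
    embedding, are to be treated. *)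
Lemma orthonormal_extend k (u : 'I_k -> V) : (k < n)%N -> orthonormal_family u ->
  exists2 x, B x x = 1 & forall i, B x (u i) = 0.
Proof.
move=> kn hu; pose proj w := w - \sum_i sc (B w (u i)) (u i).
have projP w j : B (proj w) (u j) = 0.
  rewrite BD sformNl sform_suml (bigD1 j) //= BZ hu eqxx mulr1 big1 ?addr0 ?subrr //.
  by move=> i /negbTE ij; rewrite BZ hu ij mulr0.
have [v v0] : exists v, proj v != 0.
  apply/existsP; apply: contraLR kn; rewrite negb_exists => /forallP h; rewrite -leqNgt.
  have F1 := finNzRing_gt1 F; rewrite -(leq_exp2l _ _ F1) -cardV.
  have -> : (#|F| ^ k)%N = #|{ffun 'I_k -> F}| by rewrite card_ffun card_ord.
  pose g (c : {ffun 'I_k -> F}) := \sum_i sc (c i) (u i).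
  apply: (@leq_trans #|g @: [set: {ffun 'I_k -> F}]|); last first.
    by rewrite (leq_trans (leq_imset_card _ _)) ?cardsT.
  rewrite -cardsT; apply: subset_leq_card; apply/subsetP => w _; apply/imsetP.
  exists [ffun i => B w (u i)]; first by rewrite inE.
  have /eqP e : w == \sum_i sc (B w (u i)) (u i) by rewrite -subr_eq0; have := h w;
    rewrite negbK.
  by rewrite {1}e; apply: eq_bigr => i _; rewrite ffunE.
set w := proj v in v0.
have [z wz] : exists z, B w z != 0.
  apply/existsP; apply: contra_neqT v0; rewrite negb_exists => /forallP h.
  by apply: Bnondeg => z; have := h z; rewrite negbK => /eqP.
pose z' := proj z; pose b := B w z'.
have b0 : b != 0.
  rewrite /b /z' /proj sformDr sformNr [B w (\sum_i _)]BC sform_suml big1 ?rmorph0 ?subr0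
    //.
  by move=> i _; rewrite BZ [B (u i) w]BC projP rmorph0 mulr0.
have scale x : B x x != 0 -> (forall i, B x (u i) = 0) ->
    exists2 x, B x x = 1 & forall i, B x (u i) = 0.
  move=> x0 hx; have [t ht] : exists t, t * theta t = (B x x)^-1.
    by apply: norm_surj; rewrite ?invr_eq0 // fmorphV -BC.
  exists (sc t x) => [|i]; last by rewrite BZ hx mulr0.
  by rewrite BZ sformZr mulrA ht mulVf.
have pw i : B w (u i) = 0 by exact: projP.
have pz i : B z' (u i) = 0 by exact: projP.
have eb : B w z' = b by [].
clearbody b z' w.
have [w0|] := eqVneq (B w w) 0; last by move/scale; apply.
have [z0|] := eqVneq (B z' z') 0; last by move/scale; apply.
(* With w and z' isotropic and B w z' = b, this vector has norm 2 b * theta b, nonzero in odd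
   characteristic. *)
apply: (scale (w + sc b z')); last by move=> i; rewrite BD BZ pw pz mulr0 addr0.
have two0 : 2 != 0 :> F by apply: odd_card_two_neq0; rewrite cardF oddX; move: q4; lia.
rewrite BD !sformDr !BZ !sformZr w0 z0 !mulr0 add0r addr0 [B z' w]BC eb.
by rewrite mulrC -mulr2n -mulr_natl !mulf_neq0 ?fmorph_eq0.
Qed.

Lemma orthonormal_exists : exists u : 'I_n -> V, orthonormal_family u.
Proof.
suff : forall k, (k <= n)%N -> exists u : 'I_k -> V, orthonormal_family u by move=> /(_
  n); apply.
elim=> [_|k IH kn]; first by exists (fun=> 0) => -[].
have [u hu] := IH (ltnW kn); have [x xx xu] := orthonormal_extend kn hu.
exists (fun i => if unlift ord_max i is Some j then u j else x) => i j.
case: (unliftP ord_max i) => [i' ->|->]; case: (unliftP ord_max j) => [j' ->|->].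
- by rewrite hu (inj_eq lift_inj).
- by rewrite BC xu rmorph0 eq_sym (negbTE (neq_lift _ _)).
- by rewrite xu (negbTE (neq_lift _ _)).
- by rewrite xx eqxx.
Qed.

Lemma parseval (u : 'I_n -> V) v w : orthonormal_family u ->
  B v w = \sum_i B v (u i) * theta (B w (u i)).
Proof.
move=> hu; pose g (c : {ffun 'I_n -> F}) := \sum_i sc (c i) (u i).
have gu c j : B (g c) (u j) = c j.
  rewrite sform_suml (bigD1 j) //= BZ hu eqxx mulr1 big1 ?addr0 //.
  by move=> i /negbTE ij; rewrite BZ hu ij mulr0.
have gI : injective g by move=> c d e; apply/ffunP => j; rewrite -gu e gu.
have [c ->] : exists c, v = g c.
  have : v \in codom g.
    by apply: inj_card_onto => //; rewrite cardV card_ffun card_ord.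
  by case/codomP => c; exists c.
rewrite [LHS]sform_suml; apply: eq_bigr => i _; by rewrite BZ gu -BC.
Qed.

End Orthonormal.

(** * The model F_(q^6) + F_(q^2) of the Hermitian space *)

Section Model.

Local Open Scope ring_scope.

Variables (q : nat) (F : finFieldType) (theta : {rmorphism F -> F}).
Variable form : {hermitian 'rV[F]_4 for false & theta}.
Variables (K : finFieldType) (fr : {rmorphism K -> K}) (io : {rmorphism F -> K}).
Hypotheses (q4 : (q %% 4 = 3)%N) (cardF : #|F| = (q ^ 2)%N).
Hypothesis thetaE : forall x, theta x = x ^+ q.
Hypothesis nondeg : nondegenerate form.
Hypotheses (cardK : #|K| = (q ^ 6)%N) (frE : forall x, fr x = x ^+ q).

Local Notation fr2 x := (fr (fr x)).
Local Notation bar x := (fr (fr (fr x))).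

Lemma io_theta a : io (theta a) = fr (io a).
Proof. by rewrite thetaE frE rmorphXn. Qed.

Lemma io_fr2 a : fr2 (io a) = io a.
Proof. by rewrite -!io_theta (theta_inv cardF thetaE). Qed.

Lemma io_ex c : fr2 c = c -> exists a, io a = c.
Proof.
move=> hc; have : c \in [set io a | a : F].
  have -> : [set io a | a : F] = [set c | fr2 c == c].
    apply/eqP; rewrite eqEcard (card_fr2 q4 cardK frE) card_imset ?cardF ?leqnn ?andbT;
      last first.
      exact: fmorph_inj.
    by apply/subsetP => x /imsetP[a _ ->]; rewrite inE io_fr2.
  by rewrite inE hc.
by case/imsetP => a _ ->; exists a.
Qed.

Definition trace_form (x y : K) : F := odflt 0 [pick a | io a == tr6 fr (x * bar y)].

Lemma trace_formE x y : io (trace_form x y) = tr6 fr (x * bar y).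
Proof.
rewrite /trace_form; case: pickP => [a /eqP //|h].
have [a ha] := io_ex (tr6_fr2 cardK frE (x * bar y)).
by have := h a; rewrite ha eqxx.
Qed.

Lemma trace_formD u v w : trace_form (u + v) w = trace_form u w + trace_form v w.
Proof. by apply: (fmorph_inj io); rewrite rmorphD !trace_formE mulrDl tr6D. Qed.

Lemma trace_formZ a u w : trace_form (io a * u) w = a * trace_form u w.
Proof. by apply: (fmorph_inj io); rewrite rmorphM !trace_formE -mulrA tr6Z ?io_fr2. Qed.

Lemma trace_formC u w : trace_form w u = theta (trace_form u w).
Proof.
apply: (fmorph_inj io); rewrite io_theta !trace_formE.
have e := tr6_fr2 cardK frE (u * bar w).
by rewrite -{1}e tr6_bar 3!rmorphM (fr6 cardK frE) mulrC.
Qed.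

Lemma trace_form_nondeg u : (forall w, trace_form u w = 0) -> u = 0.
Proof.
move=> h; apply/eqP; apply/negP => /negP u0.
have := card_perp6 q4 cardK frE u0.
have -> : [set w | tr6 fr (u * w) == 0] = [set: K].
  apply/setP => w; rewrite !inE -[w](fr6 cardK frE) -trace_formE h rmorph0 eqxx //.
by rewrite cardsT cardK => /eqP; rewrite eqn_exp2l //; have := q_gt2 q4; lia.
Qed.

(** Three vectors of an orthonormal basis of F^4 go to one of F_(q^6) for the trace form, the fourth
    gives the coordinate in F_(q^2); [parseval] on both sides identifies the forms. *)
Lemma hermitian_model : exists Phi : 'rV[F]_4 -> K * K,
  [/\ forall u v, Phi (u + v) = ((Phi u).1 + (Phi v).1, (Phi u).2 + (Phi v).2),
      forall a v, Phi (a *: v) = (io a * (Phi v).1, io a * (Phi v).2),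
      injective Phi,
      forall p, (fr2 p.2 == p.2) = (p \in codom Phi)
    & forall u v, io (form u v) = hform fr (Phi u) (Phi v)].
Proof.
have cV : #|'rV[F]_4| = (#|F| ^ 4)%N by rewrite card_mx mul1n.
have BC u w : form w u = theta (form u w) by rewrite hermitian_subproof expr0 mul1r.
have BD u v w : form (u + v) w = form u w + form v w by rewrite linearDl.
have BZ a u w : form (a *: u) w = a * form u w by rewrite linearZl_LR.
have ND u : (forall w, form u w = 0) -> u = 0.
  move=> h; apply/eqP; rewrite -memv0; have /eqP <- := nondeg.
  by apply/mem_orthovP => v _.
have cK : #|K| = (#|F| ^ 3)%N by rewrite cardF -expnM cardK.
have [k hk] := orthonormal_exists q4 cardF thetaE cK trace_formD trace_formZ trace_formC
  trace_form_nondeg.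
have [b hb] := orthonormal_exists q4 cardF thetaE cV BD BZ BC ND.
have PV v w := parseval cV BD BZ BC v w hb.
pose Phi v : K * K := (\sum_(i < 3) io (form v (b (widen_ord (leqnSn 3) i))) * k i,
                      io (form v (b ord_max))).
have PhiF u v : io (form u v) = hform fr (Phi u) (Phi v).
  rewrite PV big_ord_recr /= rmorphD rmorphM io_theta /hform /=; congr (_ + _).
  have coordk (c : 'I_3 -> F) j : trace_form (\sum_i io (c i) * k i) (k j) = c j.
    rewrite (sform_suml trace_formD) (bigD1 j) //= trace_formZ hk eqxx mulr1 big1 ?addr0 //.
    by move=> i /negbTE ij; rewrite trace_formZ hk ij mulr0.
  rewrite -trace_formE (parseval cK trace_formD trace_formZ trace_formC _ _ hk).
  by rewrite !rmorph_sum; apply: eq_bigr => i _; rewrite !coordk.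
have PhiI : injective Phi.
  move=> u v e; apply/eqP; rewrite -subr_eq0; apply/eqP/ND => w.
  rewrite BD -scaleN1r BZ mulN1r; apply/eqP; rewrite subr_eq0; apply/eqP.
  by apply: (fmorph_inj io); rewrite !PhiF e.
exists Phi; split=> //.
- by move=> u v; rewrite /Phi BD rmorphD -big_split /=; congr pair;
  apply: eq_bigr => i _; rewrite BD rmorphD mulrDl.
- by move=> a v; rewrite /Phi BZ rmorphM mulr_sumr /=; congr pair; apply: eq_bigr => i _;
  rewrite BZ rmorphM mulrA.
move=> p; have -> : (p \in codom Phi) = (p \in [set Phi v | v : 'rV[F]_4]).
  by apply/codomP/imsetP => [[v ->]|[v _ ->]]; exists v.
suff /setP/(_ p) <- : setX [set: K] [set c | fr2 c == c] = [set Phi v | v : 'rV[F]_4].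
  by rewrite !inE.
apply/esym/eqP; rewrite eqEcard cardsX cardsT (card_fr2 q4 cardK frE) card_imset //.
rewrite cV cardF cardK -expnM -expnD leqnn andbT.
by apply/subsetP => _ /imsetP[v _ ->]; rewrite !inE /= io_fr2.
Qed.

End Model.

(** * The hemisystem and its symmetries *)

Section Lines.

Local Open Scope ring_scope.

Variables (q : nat) (F : finFieldType) (theta : {rmorphism F -> F}).
Variable form : {hermitian 'rV[F]_4 for false & theta}.
Variables (K : finFieldType) (fr : {rmorphism K -> K}) (io : {rmorphism F -> K}).
Hypotheses (q4 : (q %% 4 = 3)%N) (cardF : #|F| = (q ^ 2)%N).
Hypothesis thetaE : forall x, theta x = x ^+ q.
Hypotheses (cardK : #|K| = (q ^ 6)%N) (frE : forall x, fr x = x ^+ q).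
Local Notation fr2 x := (fr (fr x)).
Local Notation bar x := (fr (fr (fr x))).
Variable Phi : 'rV[F]_4 -> K * K.
Hypothesis PhiD : forall u v, Phi (u + v) = ((Phi u).1 + (Phi v).1, (Phi u).2 + (Phi v).2).
Hypothesis PhiZ : forall a v, Phi (a *: v) = (io a * (Phi v).1, io a * (Phi v).2).
Hypothesis PhiI : injective Phi.
Hypothesis PhiS : forall p, (fr2 p.2 == p.2) = (p \in codom Phi).
Hypothesis PhiF : forall u v, io (form u v) = hform fr (Phi u) (Phi v).
Hypothesis io2 : forall a, fr2 (io a) = io a.

Let fr6 := fr6 cardK frE.

Lemma Phi2 v : fr2 (Phi v).2 = (Phi v).2.
Proof. by apply/eqP; rewrite PhiS codom_f. Qed.

Lemma Phi_ex p : fr2 p.2 = p.2 -> exists v, Phi v = p.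
Proof. by move/eqP; rewrite PhiS => /codomP[v ->]; exists v. Qed.

Lemma Phi0 : Phi 0 = 0.
Proof. by rewrite -(scale0r 0) PhiZ rmorph0 !mul0r. Qed.

Lemma Phi_neq0 v : v != 0 -> Phi v != 0.
Proof. by move=> v0; rewrite -Phi0 (inj_eq PhiI). Qed.

Definition vline x : {set 'rV[F]_4} := [set v | Phi v \in hline fr x].

Lemma mem_vline x v : (v \in vline x) = (Phi v \in hline fr x).
Proof. by rewrite [LHS]inE. Qed.

Lemma card_vline x : quadric fr x -> #|vline x| = (q ^ 4)%N.
Proof.
move=> qx; rewrite -(card_hline q4 cardK frE qx) -(card_imset _ PhiI).
apply: eq_card => p; apply/imsetP/idP => [[v]|hp]; first by rewrite inE => h ->.
have /hlineP[h _] := hp; have [v hv] := Phi_ex h.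
by exists v; rewrite // inE hv.
Qed.

Lemma rowset_of_closed (S : {set 'rV[F]_4}) : 0 \in S ->
  (forall u v, u \in S -> v \in S -> u + v \in S) ->
  (forall a v, v \in S -> a *: v \in S) ->
  exists A : 'M[F]_4, rowset A = S.
Proof.
move=> S0 SD SZ; exists (rowg_mx S); apply/setP => v; rewrite inE.
apply/idP/idP; last by move=> h; have /subsetP/(_ v h) := sub_rowg_mx S; rewrite inE.
rewrite genmxE => /submxP[D ->]; rewrite mulmx_sum_row.
by elim/big_ind: _ => // i _; apply: SZ; rewrite rowK enum_valP.
Qed.

Lemma vline_rowset x : quadric fr x -> exists2 A : 'M[F]_4, rowset A = vline x & \rank A
  = 2%N.
Proof.
move=> qx; have [A hA] : exists A : 'M[F]_4, rowset A = vline x.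
  apply: rowset_of_closed.
  - by rewrite inE Phi0 hline0.
  - move=> u v; rewrite !inE => /andP[/eqP u2 /eqP hu] /andP[/eqP v2 /eqP hv].
    by rewrite PhiD /= rmorphD rmorphD u2 v2 xpDr hu hv mulrDl !eqxx.
  - move=> a v; rewrite !inE => /andP[/eqP v2 /eqP hv].
    by rewrite PhiZ /= !rmorphM v2 io2 xpZr // hv mulrA !eqxx.
exists A => //; have := card_vline qx; rewrite -hA (_ : rowset A = rowg A) //.
have q2 := q_gt2 q4.
rewrite card_rowg cardF -expnM => /eqP; rewrite eqn_exp2l; last by lia.
by move/eqP; lia.
Qed.

Lemma vline_isotropic x u v : quadric fr x -> u \in vline x -> v \in vline x -> form u v
  = 0.
Proof.
move=> qx; rewrite !mem_vline => hu hv; apply: (fmorph_inj io).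
by rewrite PhiF rmorph0; apply: (hline_isotropic cardK frE qx).
Qed.

Lemma vline_hlines x : quadric fr x -> vline x \in hlines form.
Proof.
move=> qx; have [A hA rA] := vline_rowset qx; apply/imsetP; exists A => //.
rewrite inE rA eqxx hA /=; apply/forall_inP => u hu; apply/forall_inP => v hv.
by rewrite (vline_isotropic qx hu hv).
Qed.

(** By [card_meet], non-proportional points have lines with at most q^2 - 1 common nonzero vectors,
    fewer than the q^4 - 1 of one line. *)
Lemma vline_eq x x' : quadric fr x -> quadric fr x' ->
  (vline x' == vline x) = (fr (x' / x) == x' / x).
Proof.
move=> qx qx'; have x0 := quadric_neq0 qx; have x0' := quadric_neq0 qx'.
apply/eqP/eqP => [e|e]; last first.
  have r0 : x' / x != 0 by rewrite mulf_neq0 ?invr_eq0.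
  have ex : x' = (x' / x) * x by rewrite divfK.
  by rewrite /vline ex hline_Z.
have he : hline fr x' = hline fr x.
  apply/setP => p; apply/idP/idP => hp; have /hlineP[h _] := hp; have [v hv] := Phi_ex h.
    by rewrite -hv -mem_vline -e mem_vline hv.
  by rewrite -hv -mem_vline e mem_vline hv.
apply/eqP; apply/negPn/negP => nr.
have := card_meet q4 cardK frE qx qx'; rewrite he (negbTE nr) mulr0 addr0 setIid.
have := card_hline q4 cardK frE qx.
have -> : [set p in hline fr x | p != 0] = hline fr x :\ (0 : K * K).
  by apply/setP => p; rewrite !inE andbC.
have -> : #|hline fr x| = (1 + #|hline fr x :\ (0 : K * K)%R|)%N.
  by rewrite (cardsD1 (0 : K * K) (hline fr x)) hline0.
have q2 := q_gt2 q4.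
have h4 : (q ^ 4 = q ^ 2 * q ^ 2)%N by rewrite -expnD.
have h2 : (3 * 3 <= q ^ 2)%N by move: q2; rewrite -(mulnn q); nia.
move: h4 h2; set n := #|_|; move: (q ^ 2)%N (q ^ 4)%N => a b h4 h2 h.
by case: (_ == _) => /=; nia.
Qed.

Section Hemisystem.

Variable vs : K.
Hypothesis hvs : cone fr vs.
Local Notation hsign := (hsign q fr vs).

Definition hemi : {set {set 'rV[F]_4}} :=
  [set vline x | x in [set x | quadric fr x && (hsign x == 1)]].

Lemma hemiP : hemisystem form q hemi.
Proof.
split; first by apply/subsetP => L /imsetP[x]; rewrite inE => /andP[qx _] ->;
  apply: vline_hlines.
move=> P /imsetP[A]; rewrite inE => /andP[/eqP rA /forall_inP iso] ->.
have q2 := q_gt2 q4.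
have cA : #|rowset A| = (q ^ 2)%N by rewrite (_ : rowset A = rowg A) // card_rowg rA
  cardF expn1.
have [p pA p0] : exists2 p, p \in rowset A & p != 0.
  have : (1 < #|rowset A|)%N by rewrite cA; nia.
  case/card_gt1P => u [v [uA vA uv]]; have [u0|] := eqVneq u 0; last by exists u.
  by exists v => //; rewrite -u0 eq_sym.
have Pp (v : 'rV_4) : v \in rowset A -> exists a, v = a *: p.
  rewrite !inE in pA * => vA; apply/sub_rVP.
  apply: submx_trans vA _.
  by rewrite -(mxrank_leqif_sup pA) rA rank_rV p0.
have PL x : (rowset A \subset vline x) = (Phi p \in hline fr x).
  apply/subsetP/idP => [/(_ p pA)|hp v /Pp[a ->]]; first by rewrite inE.
  have /hlineP[h2 h1] := hp.
  by rewrite inE; apply/hlineP; rewrite PhiZ /= !rmorphM h2 io2 xpZr // h1 mulrA.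
have hpp : hform fr (Phi p) (Phi p) = 0.
  by have /forall_inP/(_ p pA)/eqP h := iso p pA; rewrite -PhiF h rmorph0.
have := card_hsign_point q4 cardK frE hvs (Phi_neq0 p0) (Phi2 p) hpp.
set X := [set x | _].
(* Each line comes from the q - 1 nonzero F_q-multiples of a point, so (q^2 - 1) / 2 positive
   vectors give (q + 1) / 2 lines. *)
rewrite (@card_fibers _ _ X (fun L => (L \in hemi) && (rowset A \subset L)) vline);
  last first.
  move=> x; rewrite inE => /and3P[qx px sx]; rewrite PL px andbT.
  by apply/imsetP; exists x; rewrite ?inE ?qx.
rewrite (eq_bigr (fun _ => (q - 1)%N)) => [|L /andP[/imsetP[x]]].
  rewrite sum_nat_const -cardsE; set N := #|_| => h.
  have : (N * 2 = q + 1)%N.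
    have h' : ((q - 1) * (N * 2) = (q - 1) * (q + 1))%N by rewrite -mulnn in h; nia.
    by move/eqP: h'; rewrite eqn_pmul2l; [move/eqP | lia].
  lia.
rewrite inE => /andP[qx /eqP sx] ->; rewrite PL => px.
have x0 := quadric_neq0 qx.
have <- : #|[set r : K | fr r == r] :\ 0| = (q - 1)%N.
  have := card_fr q4 cardK frE; rewrite (cardsD1 0) inE rmorph0 eqxx add1n => <-.
  by rewrite subn1.
rewrite -[RHS](card_imset _ (mulIf x0)); apply: eq_card => x'.
rewrite !inE; apply/andP/imsetP => [[/and3P[qx' px' sx'] e]|[r]].
  have x0' := quadric_neq0 qx'.
  exists (x' / x); last by rewrite divfK.
  by rewrite !inE mulf_neq0 ?invr_eq0 //= -vline_eq.
rewrite !inE => /andP[r0 /eqP hr] ->.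
have hN : fr (r * bar r) = r * bar r by rewrite !rmorphM !hr.
have qrx : quadric fr (r * x) by apply: quadric_Z.
rewrite qrx vline_eq // mulfK // hr eqxx.
rewrite (hsign_Z q4 cardK frE hvs) // ?sx ?eqxx; last by apply: quartic1 => //; rewrite !hr.
by have := px; rewrite -(@hline_Z _ fr r x) // inE => ->.
Qed.

(* A bijection of the model F_(q^6) + F_(q^2) transported to F^4. *)
Lemma Phi_perm (h : K * K -> K * K) :
  (forall p, fr2 p.2 = p.2 -> fr2 (h p).2 = (h p).2) -> injective h ->
  exists g : {perm 'rV[F]_4}, forall v, Phi (g v) = h (Phi v).
Proof.
move=> hS hI; pose g v := odflt 0 [pick w | Phi w == h (Phi v)].
have gE v : Phi (g v) = h (Phi v).
  rewrite /g; case: pickP => [w /eqP //|n].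
  by have [w hw] := Phi_ex (hS _ (Phi2 v)); have := n w; rewrite hw eqxx.
have gI : injective g by move=> u v e; apply/PhiI/hI; rewrite -!gE e.
by exists (perm gI) => v; rewrite permE.
Qed.

Lemma linear_GammaU (g : {perm 'rV[F]_4}) (z c : K) (r : F) :
  (forall v, Phi (g v) = (z * (Phi v).1, c * (Phi v).2)) -> r != 0 ->
  (forall u v, form (g u) (g v) = r * form u v) -> g \in GammaU form.
Proof.
move=> hg r0 hform; apply/GammaUP; exists 1%g, r; split=> //.
- by apply/field_automorphismP; split=> *; rewrite !perm1.
- apply/semilinear_overP; split=> [u v|a v]; apply: PhiI.
    by rewrite PhiD !hg PhiD /= !mulrDr.
  by rewrite perm1 PhiZ !hg PhiZ /=; congr pair; ring.
- by apply/semisimilarityP => u v; rewrite hform perm1.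
Qed.

Lemma vline_image (g : {perm 'rV[F]_4}) x x' : quadric fr x -> quadric fr x' ->
  (forall v, v \in vline x -> g v \in vline x') -> [set g v | v in vline x] = vline x'.
Proof.
move=> qx qx' h; apply/eqP; rewrite eqEcard card_imset; last exact: perm_inj.
rewrite !card_vline // leqnn andbT.
by apply/subsetP => w /imsetP[v hv ->]; apply: h.
Qed.

Lemma hemi_stable (g : {perm 'rV[F]_4}) (h : K -> K) : g \in GammaU form ->
  (forall x, quadric fr x -> quadric fr (h x) /\ hsign (h x) = hsign x) ->
  (forall x v, quadric fr x -> v \in vline x -> g v \in vline (h x)) ->
  coset (scalar_perms F) g \in PGammaU_stabiliser form hemi.
Proof.
move=> Gg hh hv; have Ng := subsetP (GammaU_norm_scalars form) _ Gg.
rewrite inE; apply/andP; split; first by rewrite /PGammaU /= mem_quotient.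
rewrite inE; apply/andP; split; first by rewrite /= mem_quotient ?inE.
rewrite inE; apply/subsetP => L /imsetP[x]; rewrite !inE => /andP[qx /eqP sx] ->.
have [qhx shx] := hh x qx; have [A hA _] := vline_rowset qx.
rewrite -hA (subspace_actionE A Gg) hA (@vline_image g x (h x)) //; last by move=> v;
  exact: hv.
by apply/imsetP; exists (h x); rewrite // inE qhx shx sx /=.
Qed.

Definition norm_Fq z := (z != 0) && (fr (z * bar z) == z * bar z).
(* The factor by which the second coordinate must be multiplied for
   multiplication by z to map the line of x to the line of z * x. *)
Definition cofactor6 z := fr2 z * fr (bar z) / bar z.

Lemma norm_FqP z : reflect (z != 0 /\ fr (z * bar z) = z * bar z) (norm_Fq z).
Proof. by apply: (iffP andP) => -[h1 h2]; split=> //; apply/eqP. Qed.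

Lemma cofactor6_neq0 z : z != 0 -> cofactor6 z != 0.
Proof. by move=> z0; rewrite !mulf_neq0 ?invr_eq0 ?fmorph_eq0. Qed.

Lemma cofactor6_fr2 z : norm_Fq z -> fr2 (cofactor6 z) = cofactor6 z.
Proof.
move=> /norm_FqP[z0 hz]; rewrite /cofactor6 !fmorph_div !rmorphM fr6.
apply/eqP; rewrite eqr_div ?fmorph_eq0 //; apply/eqP.
have e : fr2 z * fr2 (bar z) = z * bar z by rewrite -!rmorphM hz.
by transitivity (fr (bar z) * (z * bar z)); [ring | rewrite -e; ring].
Qed.

Lemma cofactor6_norm z : norm_Fq z -> cofactor6 z * fr (cofactor6 z) = z * bar z.
Proof.
move=> /norm_FqP[z0 hz]; have e : fr2 z * fr2 (bar z) = z * bar z by rewrite -!rmorphM !hz.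
rewrite -e /cofactor6 !fmorph_div !rmorphM.
by field; rewrite !fmorph_eq0 z0.
Qed.

Lemma similitude_ex z : norm_Fq z -> exists g : {perm 'rV[F]_4},
  [/\ g \in GammaU form, forall v, Phi (g v) = (z * (Phi v).1, cofactor6 z * (Phi v).2)
    & forall x v, quadric fr x -> v \in vline x -> g v \in vline (z * x)].
Proof.
move=> hz; have [z0 hN] := norm_FqP _ hz; have c0 := cofactor6_neq0 z0.
have hc := cofactor6_fr2 hz; have cN := cofactor6_norm hz.
have cz : cofactor6 z * bar z = fr2 z * fr (bar z) by rewrite divfK ?fmorph_eq0.
move: (cofactor6 z) c0 hc cN cz => c c0 hc cN cz.
have [||g hg] := @Phi_perm (fun p => (z * p.1, c * p.2)).
- by move=> p hp /=; rewrite 2!rmorphM hp hc.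
- by move=> [y a] [y' a'] /= [/(mulfI z0) -> /(mulfI c0) ->].
have n0 : z * bar z != 0 by rewrite mulf_neq0 ?fmorph_eq0.
have [r hr] : exists r, io r = z * bar z by apply: (io_ex io q4 cardF thetaE cardK frE);
  rewrite ?hN.
have r0 : r != 0 by apply: contraNneq n0 => r0; rewrite -hr r0 rmorph0.
exists g; split=> //.
  apply: (linear_GammaU hg r0) => u v.
  apply: (fmorph_inj io); rewrite rmorphM hr !PhiF !hg /hform /= !rmorphM mulrACA.
  have hN2 : fr2 (z * bar z) = z * bar z by rewrite !hN.
  by rewrite (tr6Z _ hN2) [c * _ * _]mulrACA cN; ring.
move=> x v qx; rewrite !mem_vline => /hlineP[h2 h1]; apply/hlineP;
  rewrite hg /= !rmorphM h2 hc.
split=> //; have -> : xp fr (z * x) (z * (Phi v).1) = fr2 z * fr (bar z) * xp fr x (Phi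
  v).1.
  by rewrite /xp !rmorphM; ring.
by rewrite h1 -cz; ring.
Qed.

Lemma frobenius_ex : exists g : {perm 'rV[F]_4},
  [/\ g \in GammaU form, forall v, Phi (g v) = (fr2 (Phi v).1, (Phi v).2)
    & forall x v, quadric fr x -> v \in vline x -> g v \in vline (fr2 x)].
Proof.
have [||g hg] := @Phi_perm (fun p => (fr2 p.1, p.2)).
- by [].
- by move=> [y a] [y' a'] /= [/fmorph_inj/fmorph_inj -> ->].
exists g; split=> //.
  apply/GammaUP; exists 1%g, 1; split; rewrite ?oner_eq0 //.
  - by apply/field_automorphismP; split=> *; rewrite !perm1.
  - apply/semilinear_overP; split=> [u v|a v]; apply: PhiI.
      by rewrite PhiD !hg PhiD /= !rmorphD.
    by rewrite perm1 PhiZ !hg PhiZ /= !rmorphM io2.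
  - apply/semisimilarityP => u v; rewrite perm1 mul1r; apply: (fmorph_inj io).
    rewrite !PhiF !hg /hform /=; congr (_ + _).
    by rewrite -!rmorphM -[RHS](tr6_fr2 cardK frE) /tr6 !rmorphD.
move=> x v qx; rewrite !mem_vline => /hlineP[h2 h1]; apply/hlineP; rewrite hg /=.
split=> //; have -> : xp fr (fr2 x) (fr2 (Phi v).1) = fr2 (xp fr x (Phi v).1).
  by rewrite /xp !rmorphB !rmorphM.
by rewrite h1 !rmorphM h2.
Qed.

Lemma finField_generator : exists2 g : K, g != 0 & forall k, (g ^+ k == 1) = (#|K|.-1 %|
  k)%N.
Proof.
have /cyclicP[u hu] := field_unit_group_cyclic [set: {unit K}]%G.
exists (val u) => [|k]; first by rewrite -unitfE; exact: valP u.
by rewrite -card_finField_unit hu -orderE order_dvdn -val_eqE /= FinRing.val_unitX.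
Qed.

Lemma cyclic_similitude : exists z, [/\ norm_Fq z, quartic q fr z = 1
  & forall k, (fr (z ^+ k) == z ^+ k) = ((q ^ 3 + 1) %/ 4 %| k)%N].
Proof.
have [g g0 hg] := finField_generator; have q2 := q_gt2 q4.
set n := (q ^ 2 + q + 1)%N; set m := ((q ^ 3 + 1) %/ 4)%N.
have m4 : (q ^ 3 + 1 = 4 * m)%N by rewrite (q3E q4) /m (q3E q4); lia.
have nq : (n * (q - 1) = q ^ 3 - 1)%N.
  have [r hr] : exists r, q = (r + 1)%N by exists (q - 1)%N; lia.
  by rewrite /n hr addnK -[LHS](addnK 1%N); congr (_ - _)%N; ring.
have cK : (#|K|.-1 = (q ^ 3 - 1) * (4 * m))%N.
  rewrite cardK -m4 -subn1 -[in LHS](exp1n 6) -[6%N]/(3 * 2)%N !expnM subn_sqr.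
  by rewrite exp1n.
have q31 : (0 < q ^ 3 - 1)%N by rewrite subn_gt0 -[X in (X < _)%N](expn0 q) ltn_exp2l; lia.
(* As n = (q^3 - 1) / (q - 1), the power g^n generates the elements with norm in F_q; the factor 4
   passes to fourth powers. *)
pose z := g ^+ (4 * n); have z0 : z != 0 by rewrite expf_neq0.
have frz k : (fr (z ^+ k) == z ^+ k) = (m %| k)%N.
  rewrite frE -exprM -[RHS](dvdn_pmul2l q31).
  have e : (k * q = k + k * (q - 1))%N by rewrite -mulnS subn1 prednK //; lia.
  rewrite e exprD -[X in _ == X]mulr1 (inj_eq (mulfI (expf_neq0 k z0))) /z -exprM hg cK.
  rewrite (_ : 4 * n * (k * (q - 1)) = 4 * ((q ^ 3 - 1) * k))%N; last by rewrite -nq; ring.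
  by rewrite (_ : (q ^ 3 - 1) * (4 * m) = 4 * ((q ^ 3 - 1) * m))%N ?dvdn_pmul2l //; ring.
exists z; split=> //.
  apply/norm_FqP; split=> //; rewrite (bar_expE frE) -exprS; apply/eqP; rewrite frz.
  by rewrite -addn1 m4 dvdn_mull.
rewrite /quartic (bar_expE frE).
have q3 : (q ^ 3 = (q ^ 3 - 1) + 1)%N by lia.
rewrite {1}q3 exprD expr1 mulfK // -exprM.
have -> : (q ^ 3 %/ 4).+1 = m by rewrite /m {2}(q3E q4); lia.
rewrite /z -exprM; apply/eqP; rewrite hg cK; apply/dvdnP; exists n; ring.
Qed.

Lemma scalar_permsE (g : {perm 'rV[F]_4}) : g \in scalar_perms F ->
  exists2 a, a != 0 & forall v, Phi (g v) = (io a * (Phi v).1, io a * (Phi v).2).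
Proof. by case/scalar_permsP => a a0 h; exists a => // v; rewrite h PhiZ. Qed.

Lemma hemi_group : exists G A B : {group coset_of (scalar_perms F)},
  [/\ G \subset PGammaU_stabiliser form hemi, (A ><| B)%g = G,
      cyclic A /\ #|A| = ((q ^ 3 + 1) %/ 4)%N & cyclic B /\ #|B| = 3].
Proof.
have [z [hz cz hk]] := cyclic_similitude; have [z0 hN] := norm_FqP _ hz.
have [g [Gg hg gl]] := similitude_ex hz.
have [f [Gf hf fl]] := frobenius_ex.
have Ng := subsetP (GammaU_norm_scalars form) _ Gg.
have Nf := subsetP (GammaU_norm_scalars form) _ Gf.
set n := ((q ^ 3 + 1) %/ 4)%N in hk *.
have hgk k v : Phi ((g ^+ k)%g v) = (z ^+ k * (Phi v).1, cofactor6 z ^+ k * (Phi v).2).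
  elim: k => [|k IH]; first by rewrite expg0 perm1 !expr0 !mul1r -surjective_pairing.
  by rewrite expgSr permM hg IH /= !exprS !mulrA.
have hfk k v : Phi ((f ^+ k)%g v) = (iter k (fun y => fr2 y) (Phi v).1, (Phi v).2).
  elim: k => [|k IH]; first by rewrite expg0 perm1 -surjective_pairing.
  by rewrite expgSr permM hf IH.
have cosetX h k : h \in GammaU form -> ((coset (scalar_perms F) h ^+ k == 1)%g) = ((h ^+
  k)%g \in scalar_perms F).
  move=> Gh; have Nh := subsetP (GammaU_norm_scalars form) _ Gh.
  rewrite -morphX //; apply/eqP/idP => [e|]; last exact: coset_id.
  by apply: coset_idr => //; apply: groupX.
have cX k : cofactor6 z ^+ k = cofactor6 (z ^+ k).
  by rewrite /cofactor6 expr_div_n exprMn -!rmorphXn.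
have e11 y : exists v, Phi v = (y, 1) by apply: Phi_ex; rewrite /= !rmorph1.
(* Otherwise [fr2] would be multiplication by a constant, equal to 1 on evaluating at 1, so [fr2]
   would be the identity of F_(q^6). *)
have fnA k : coset (scalar_perms F) f <> (coset (scalar_perms F) g ^+ k)%g.
  rewrite -morphX // => e.
  have Ngk : (g ^+ k)%g \in 'N(scalar_perms F)%g by rewrite groupX.
  have : (f * (g ^+ k)^-1)%g \in scalar_perms F.
    by rewrite -mem_rcoset; apply/rcoset_kercosetP.
  move=> /scalar_permsE[a a0 ha].
  have fE v : Phi (f v) = (z ^+ k * (io a * (Phi v).1), cofactor6 z ^+ k * (io a * (Phi
    v).2)).
    by rewrite -[f](mulgKV (g ^+ k)%g) permM hgk ha.
  have fE1 y : fr2 y = z ^+ k * (io a * y).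
    by have [v hv] := e11 y; have := fE v; rewrite hf hv => -[].
  have one : z ^+ k * io a = 1 by have := fE1 1; rewrite !rmorph1 mulr1.
  have := card_fr2 q4 cardK frE.
  have -> : [set x : K | fr2 x == x] = [set: K].
    by apply/setP => y; rewrite !inE fE1 mulrA one mul1r eqxx.
  by rewrite cardsT cardK => /eqP; rewrite (eqn_exp2l _ _ (ltnW (q_gt2 q4))).
have ordA : #[coset (scalar_perms F) g]%g = n.
  have H k : (#[coset (scalar_perms F) g]%g %| k)%N = (n %| k)%N.
    rewrite order_dvdn cosetX // -hk; have t0 : z ^+ k != 0 by rewrite expf_neq0.
    apply/idP/eqP => [/scalar_permsE[a a0 ha]|ht].
      (* A scalar multiplies both coordinates alike: t = z^k is in F_(q^2) and equals its cofactor
         t^2 / fr t, so t is in F_q. *)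
      have [v hv] := e11 1; have := ha v; rewrite hgk hv /= !mulr1 cX => -[e1 e2].
      have t2 : fr2 (z ^+ k) = z ^+ k by rewrite e1 io2.
      have bt : bar (z ^+ k) = fr (z ^+ k) by rewrite t2.
      have : cofactor6 (z ^+ k) * bar (z ^+ k) = fr2 (z ^+ k) * fr (bar (z ^+ k)).
        by rewrite divfK ?fmorph_eq0.
      by rewrite e2 -e1 bt !t2 => /(mulfI t0).
    have [a ha] : exists a, io a = z ^+ k by apply: (io_ex io q4 cardF thetaE cardK frE);
      rewrite !ht.
    apply/scalar_permsP; exists a.
      by apply: contraNneq t0 => a0; rewrite -ha a0 rmorph0.
    move=> v; apply: PhiI; rewrite hgk PhiZ ha cX; congr (_, _ * _).
    by rewrite /cofactor6 !ht mulfK.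
  by apply/eqP; rewrite eqn_dvd H dvdnn -H dvdnn.
have ordB : #[coset (scalar_perms F) f]%g = 3.
  have d3 : (#[coset (scalar_perms F) f]%g %| 3)%N.
    rewrite order_dvdn cosetX // (_ : (f ^+ 3)%g = 1%g) ?group1 //.
    by apply/permP => v; apply: PhiI; rewrite hfk /= fr6 perm1 -surjective_pairing.
  apply/eqP; have /orP[/eqP o1|//] : (#[coset (scalar_perms F) f]%g == 1%N) || (#[coset
    (scalar_perms F) f]%g == 3).
    by have [_] := primeP (isT : prime 3); apply.
  by case: (fnA 0%N); apply/eqP; rewrite expg0 -order_eq1 o1.
pose A := <[coset (scalar_perms F) g]>%G; pose B := <[coset (scalar_perms F) f]>%G.
have nAB : B \subset 'N(A)%g.
  rewrite /= norms_cycle -morphJ //.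
  (* Conjugation by the Frobenius x |-> x^(q^2) raises the multiplier z to the power q^2, and the
     cofactor, being in F_(q^2), equals its own q^2-th power. *)
  have -> : (g ^ f)%g = (g ^+ (q ^ 2))%g.
    rewrite conjgE; apply: (mulgI f); rewrite mulgA mulgV mul1g.
    apply/permP => v; apply: PhiI; rewrite !permM hf hg hgk hf /= rmorphM rmorphM.
    by rewrite -(fr_iterE frE 2 z) -(fr_iterE frE 2 (cofactor6 z)) /= cofactor6_fr2.
  by rewrite morphX // mem_cycle.
have tAB : (A :&: B = 1)%g.
  rewrite setIC; apply: prime_TIg; first by rewrite -orderE ordB.
  rewrite cycle_subG; apply/negP => /cycleP[k]; exact: fnA.
exists (A <*> B)%G, A, B; split.
- rewrite /= join_subG !cycle_subG; apply/andP; split.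
    apply: (hemi_stable (h := fun x => z * x)) => // x qx; split; first exact: quadric_Z.
    exact: (hsign_Z q4 cardK frE hvs).
  apply: (hemi_stable (h := fun x => fr2 x)) => // x qx; split; first exact: quadric_fr2.
  exact: (hsign_fr2 q4 cardK frE hvs).
- by rewrite sdprodE //= norm_joinEr.
- by rewrite cycle_cyclic -orderE.
- by rewrite cycle_cyclic -orderE.
Qed.

End Hemisystem.

End Lines.

Lemma iter_Frobenius (K : finFieldType) (p e : nat) : (p \in [pchar K])%R ->
  exists fr : {rmorphism K -> K}, forall x, fr x = (x ^+ (p ^ e))%R.
Proof.
move=> pK; elim: e => [|e [fr IH]]; first by exists idfun.
exists (pFrobenius_aut pK \o fr) => x /=.
by rewrite pFrobenius_autE IH -GRing.exprM expnSr.
Qed.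

Theorem theorem1p1 (p e q : nat) (F : finFieldType)
    (theta : {rmorphism F -> F})
    (form : {hermitian 'rV[F]_4 for false & theta}%R) :
  prime p -> (0 < e)%N -> q = (p ^ e)%N -> (q %% 4 = 3)%N ->
  #|F| = (q ^ 2)%N ->
  (forall x : F, theta x = x ^+ q)%R ->
  nondegenerate form ->
  exists H : {set {set 'rV[F]_4}},
    hemisystem form q H /\
    exists G A B : {group coset_of (scalar_perms F)},
      [/\ G \subset PGammaU_stabiliser form H,
          (A ><| B)%g = G,
          cyclic A /\ #|A| = ((q ^ 3 + 1) %/ 4)%N
        & cyclic B /\ #|B| = 3].
Proof.
move=> p_pr _ qE q4 cardF thetaE nondeg.
have [K [io cardK']] := finField_extension F (isT : 0 < 3).
have cardK : #|K| = q ^ 6 by rewrite cardK' cardF -expnM.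
have pK : (p \in [pchar K])%R.
  by apply: (@card_finPcharP _ p (e * 6)); rewrite // cardK qE -expnM.
have [fr] := iter_Frobenius e pK; rewrite -qE => frE.
have [Phi [PhiD PhiZ PhiI PhiS PhiF]] :=
  hermitian_model io q4 cardF thetaE nondeg cardK frE.
have io2 := io_fr2 io cardF thetaE frE.
have [vs hvs] := cone_ex q4 cardK frE.
exists (hemi q fr Phi vs); split; first exact: hemiP.
exact: hemi_group.
Qed.
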